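(* Let $A$ be a metric space endowed with a Borel probability measure $\mu$, and suppose there are $d>0$ and $\epsilon'>0$ such that $\mu(B(x,r))\ge\epsilon' r^d$ for all $r\in(0,1)$ and $x\in A$. Let $X_1,X_2,\ldots$ be independent $\mu$-distributed random elements of $A$. Let $\beta\in[0,\infty]$ and let $k:\mathbb{N}\to\mathbb{N}$ satisfy $\lim_{n\to\infty}k(n)/\log n=\beta$ and $\lim_{n\to\infty}k(n)/n=0$. Let $a>0$, $b\ge0$, and suppose $\nu(r,ar^d)=\Omega(r^{-b})$ as $r\downarrow0$. Then, almost surely: if $\beta=\infty$ then $$\liminf_{n\to\infty}\left(nL_{n,k(n)}^d/k(n)\right)\ge 1/a,$$ and if $\beta<\infty$ then $$\liminf_{n\to\infty}\left(nL_{n,k(n)}^d/\log n\right)\ge a^{-1}\hat H_\beta(b/d).$$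
   Context: $\mathbb{N}=\{1,2,\ldots\}$. $B(x,r)=\{y\in A:\operatorname{dist}(x,y)\le r\}$ is the closed ball. For $r>0,a>0$, the packing number $\nu(r,a)$ is the largest number $m$ such that there exists a collection of $m$ disjoint closed balls of radius $r$ centred on points of $A$, each with $\mu$-measure at most $a$. For functions $g_1$ (real-valued) and $g_2>0$ on $(0,s)$, $g_1(r)=\Omega(g_2(r))$ as $r\downarrow0$ means $\liminf_{r\downarrow0}g_1(r)/g_2(r)>0$. $\mathcal{X}_n=\{X_1,\ldots,X_n\}$, regarded as a point process, and $\mathcal{X}_n(D)$ is the number of points of $\mathcal{X}_n$ in $D$ (counted with multiplicity, i.e. the number of $i\le n$ with $X_i\in D$). $L_{n,k}=\inf\{r>0:\mathcal{X}_n(B(x,r))\ge k+1\ \forall x\in\mathcal{X}_n\}$, with $\inf\varnothing=+\infty$. $H(t)=1-t+t\log t$ for $t>0$ and $H(0)=1$. For $a\in[0,\infty)$, $\hat H_a:[0,\infty)\to[a,\infty)$ is defined by: $y=\hat H_a(x)$ if and only if $yH(a/y)=x$ and $y\ge a$, with $\hat H_0(0)=0$. (Thus $\hat H_0(x)=x$ and $\hat H_a(0)=a$.) *)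

(* Defs.v *)
From HB Require Import structures.
From mathcomp Require Import all_boot all_order all_algebra.
From mathcomp Require Import finmap ring lra.
From mathcomp Require Import all_classical all_reals all_analysis.

Set Implicit Arguments.
Unset Strict Implicit.
Unset Printing Implicit Defensive.

Import Order.TTheory GRing.Theory Num.Theory.
Import numFieldNormedType.Exports.

Local Open Scope classical_set_scope.
Local Open Scope ring_scope.

(* A measurable type of the library carries a distinguished point, so the metric
   space has to carry one as well. A space with a probability measure is
   nonempty, hence any such space can be given one. *)
#[short(type="pointedMetricType")]
HB.structure Definition PointedMetric (K : numDomainType) :=
  {M of Metric K M & Pointed M}.

Definition borelType (T : ptopologicalType) := g_sigma_algebraType (@open T).

(* Not the library's [closed_ball], which is the closure of the open ball and
   can be smaller in a general metric space. *)
Definition cball (R : realType) (A : metricType R) (x : A) (r : R) : set A :=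
  [set y | mdist x y <= r].

Definition mutually_independent (R : realType) (I : choiceType)
    (d d' : measure_display) (Omega : measurableType d) (T : measurableType d')
    (P : probability Omega R) (X : I -> {RV P >-> T}) : Prop :=
  forall (J : {fset I}) (B : I -> set T),
    (forall j, j \in J -> measurable (B j)) ->
    P (\bigcap_(j in [set` J]) X j @^-1` B j) =
      (\prod_(j <- J) P (X j @^-1` B j))%E.

(* Valued in [\bar R]: the supremum is +oo if there are such collections of
   every finite size; otherwise it is the largest size. *)
Definition packing_number (R : realType) (A : metricType R)
    (mu : set A -> \bar R) (r a : R) : \bar R :=
  ereal_sup [set m%:R%:E | m in [set m : nat | exists x : 'I_m -> A,
    trivIset setT (fun i => cball (x i) r) /\
    forall i, (mu (cball (x i) r) <= a%:E)%E]].

Definition bigOmega_at0 (R : realType) (g1 : R -> \bar R) (g2 : R -> R) : Prop :=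
  (0 < limf_einf (fun r => g1 r * ((g2 r)^-1)%:E) 0^'+)%E.

(* The sample [X_1, ..., X_n] is [x 0, ..., x n.-1]; points are counted with
   multiplicity. *)
Definition npoints (T : Type) (x : nat -> T) (n : nat) (D : set T) : nat :=
  (\sum_(i < n) (x i \in D))%N.

Definition Lnk (R : realType) (A : metricType R) (x : nat -> A) (n k : nat) :
    \bar R :=
  ereal_inf [set r%:E | r in [set r : R | 0 < r /\
    forall i : 'I_n, (k.+1 <= npoints x n (cball (x i) r))%N]].

Definition H (R : realType) (t : R) : R :=
  if t == 0 then 1 else 1 - t + t * ln t.

(* [Hhat_spec] below shows that the solution exists and is unique, so that the
   value of [get] is never a default one. For [a = x = 0] it is [y = 0], since
   [0 / 0 = 0]. *)
Definition Hhat (R : realType) (a x : R) : R :=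
  get [set y : R | a <= y /\ y * H (a / y) = x].

Lemma Hhat_solE (R : realType) (a t : R) : 0 < a ->
  a * expR t * H (a / (a * expR t)) = a * (expR t - 1 - t).
Proof.
move=> a0; have at0 : expR t != 0 by rewrite gt_eqF// expR_gt0.
have a00 : a != 0 by rewrite gt_eqF.
have -> : a / (a * expR t) = expR (- t).
  by rewrite expRN invfM mulrA divff// mul1r.
rewrite /H gt_eqF ?expR_gt0// expRK expRN.
by field.
Qed.

Lemma Hhat_sol_ex (R : realType) (a x : R) : 0 <= a -> 0 <= x ->
  exists y, a <= y /\ y * H (a / y) = x.
Proof.
rewrite le_eqVlt => /predU1P[<- x0|a0 x0].
  by exists x; rewrite mul0r /H eqxx mulr1.
pose T : R := 2 * (x / a + 1).
have xa0 : 0 <= x / a by rewrite divr_ge0// ltW.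
have T0 : 0 <= T by rewrite mulr_ge0// addr_ge0.
pose g (t : R) := a * (expR t - 1 - t).
have gc : {within `[0, T], continuous g}.
  apply: continuous_subspaceT => t; apply: cvgM; first exact: cvg_cst.
  apply: cvgB; last exact: cvg_id.
  apply: cvgB; [exact: continuous_expR|exact: cvg_cst].
have g0 : g 0 = 0 by rewrite /g expR0 subrr sub0r oppr0 mulr0.
have gT : x <= g T.
  have -> : x = a * (x / a) by rewrite mulrCA divff ?mulr1// gt_eqF.
  rewrite /g ler_pM2l//.
  have hT : 1 + (x / a + 1) <= expR (x / a + 1) by exact: expR_ge1Dx.
  have -> : expR T = expR (x / a + 1) ^+ 2 by rewrite expr2 -expRD /T mulrDl mul1r.
  rewrite /T; nra.
have [|t] := @IVT R g 0 T x T0 gc.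
  rewrite g0 (min_idPl _) ?(max_idPr _) ?x0 ?gT// (le_trans x0)//.
rewrite in_itv/= => /andP[t0 _] <-; exists (a * expR t).
by rewrite Hhat_solE// ler_peMr ?(ltW a0)// -expR0 ler_expR.
Qed.

Lemma Hhat_sol_inj (R : realType) (a y z : R) : 0 <= a -> a <= y -> a <= z ->
  y * H (a / y) = z * H (a / z) -> y = z.
Proof.
rewrite le_eqVlt => /predU1P[<- _ _|a0].
  by rewrite !mul0r /H eqxx !mulr1.
have par u : a <= u -> exists2 t, 0 <= t & u = a * expR t.
  move=> au; have ua : 1 <= u / a by rewrite ler_pdivlMr// mul1r.
  exists (ln (u / a)); first exact: ln_ge0.
  rewrite lnK ?posrE ?(lt_le_trans _ ua)//.
  by rewrite mulrCA divff ?mulr1// gt_eqF.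
have inc (s t : R) : 0 <= s -> s < t -> expR s - 1 - s < expR t - 1 - t.
  move=> s0 st.
  have e1 : 1 <= expR s by rewrite -expR0 ler_expR.
  have h : 1 + (t - s) / 2 <= expR ((t - s) / 2) by exact: expR_ge1Dx.
  have hts : expR t = expR s * expR ((t - s) / 2) ^+ 2.
    by rewrite expr2 -!expRD; congr expR; field.
  have q : 1 + (t - s) < expR ((t - s) / 2) ^+ 2 by nra.
  rewrite hts; nra.
move=> /par[s s0 ->] /par[t t0 ->]; rewrite !Hhat_solE//.
move=> /(mulfI (lt0r_neq0 a0)) st; congr (_ * expR _).
by case: (ltgtP s t) => // [/(inc s t s0)|/(inc t s t0)]; rewrite st ltxx.
Qed.

Lemma Hhat_spec (R : realType) (a x y : R) : 0 <= a -> 0 <= x ->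
  Hhat a x = y <-> y * H (a / y) = x /\ a <= y.
Proof.
move=> a0 x0; have [ah hx] : a <= Hhat a x /\ Hhat a x * H (a / Hhat a x) = x.
  exact: (getPex (Hhat_sol_ex a0 x0)).
split=> [<-//|[yx ay]]; apply: (Hhat_sol_inj a0 ah ay).
by rewrite hx yx.
Qed.

(* Main.v *)
Require Import Defs.
From HB Require Import structures.
From mathcomp Require Import all_boot all_order all_algebra.
From mathcomp Require Import finmap ring lra zify.
From mathcomp Require Import all_classical all_reals all_analysis.
From mathcomp Require Import measurable_realfun.

(** A single ball decides. If a ball of radius [r] contains at most [k] sample
    points, and one of them lies in its core of radius [r - s], then the ball of
    radius [s] around that point contains at most [k] sample points, so that the
    threshold is at least [s] ([Lnk_ge]). The packing hypothesis provides balls of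
    small measure, and the lower bound on the measure of balls makes their cores
    likely enough to be hit ([packing_cores]). Write [u] for [r ^ d]; the radius is
    chosen so that [n * a * u], which bounds the mean number of points in a ball, is
    [v] times [k n] or [ln n], and [s ^ d = rho * u] with [rho] close to [1]. Then the
    normalised threshold is about [rho * v / a], and it remains to see for which
    [v] some ball succeeds.

    If [k n / ln n] tends to infinity, or if [b = 0], one ball is enough, with [v]
    less than [1] and less than [beta] respectively: the ball has on average fewer
    points than it may contain, and Chernoff's bound shows that it fails with
    probability exponentially small in [k n], respectively in [ln n]
    ([one_ball_rate]).

    If [b > 0] and [beta] is finite, the mean number of points in a ball may exceed
    the number allowed. A ball succeeds with probability at least about
    [n ^ - (v * H (beta / v))], by a lower bound for the binomial law that rests on
    Stirling's formula ([binom_lt_rate]). There are about [n ^ (b / d)] disjoint balls, so that the mean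
    number of successes is a positive power of [n] as long as
    [v * H (beta / v) < b / d]. As the limiting case of equality defines
    [Hhat beta (b / d)] and the left-hand side is homogeneous in [(beta, v)], this
    is satisfied for [rho * beta] and [v = rho * Hhat beta (b / d)]. Counts in disjoint
    balls are negatively dependent ([trinom_lt_le]), hence the number of successes has a
    small relative variance, and Chebyshev's inequality bounds the probability that
    there is none by a negative power of [n] ([many_balls], [many_balls_rate]).

    In the logarithmic regime such a power may be too small to be summable over
    [n]. The events are therefore considered only for the sizes [(j + 1) ^ K],
    with [K] large, in a form that controls all sizes between two consecutive ones:
    a core is hit by the points of the smaller sample, and the ball contains few points
    of the larger one. As the ratio of consecutive sizes tends to [1], nothing is lost
    in the limit ([ae_log_threshold_ge]). *)

Set Implicit Arguments.
Unset Strict Implicit.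
Unset Printing Implicit Defensive.

Import Order.TTheory GRing.Theory Num.Theory.
Import numFieldNormedType.Exports.

Local Open Scope classical_set_scope.
Local Open Scope ring_scope.

(** * Lower tails of binomial and trinomial laws *)

(** Written as a recursion on the number [N] of trials, because that is how
    conditioning on one sample point produces it: it is the probability that
    a binomial variable of parameters [N] and [p] is less than [l]. The strict
    inequality makes the truncated predecessor correct at [l = 0]. *)
Fixpoint binom_lt (R : realType) (N l : nat) (p : R) : R :=
  if N is N'.+1 then (1 - p) * binom_lt N' l p + p * binom_lt N' l.-1 p
  else (0 < l)%N%:R.

(** The joint version for the numbers of trials with the first and with the
    second of two exclusive outcomes, of probabilities [p] and [q]. *)
Fixpoint trinom_lt (R : realType) (N l1 l2 : nat) (p q : R) : R :=
  if N is N'.+1 then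
    (1 - p - q) * trinom_lt N' l1 l2 p q + p * trinom_lt N' l1.-1 l2 p q
      + q * trinom_lt N' l1 l2.-1 p q
  else ((0 < l1)%N && (0 < l2)%N)%:R.

Section binom_lt.
Context {R : realType}.
Implicit Types (p q z : R) (N l : nat).

Lemma binom_lt0 N p : binom_lt N 0 p = 0.
Proof. by elim: N => //= N ->; rewrite !mulr0 addr0. Qed.

Lemma binom_lt_step_mono N l p : 0 <= p <= 1 ->
  binom_lt N l.-1 p <= binom_lt N l p.
Proof.
move=> /andP[p0 p1]; elim: N l => [|N IH] [|l] //=; first by case: l.
by rewrite lerD// ler_wpM2l// ?subr_ge0//; exact: (IH l.+1).
Qed.

Lemma binom_lt_ge0 N l p : 0 <= p <= 1 -> 0 <= binom_lt N l p.
Proof.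
move=> /andP[p0 p1]; elim: N l => [|N IH] l //=.
by rewrite addr_ge0// mulr_ge0// subr_ge0.
Qed.

(** Induction on [N] replaces a coupling: both values at [p] are at least those
    at [p'], and moving weight towards the smaller one lowers the average. *)
Lemma binom_lt_anti N l p p' : 0 <= p -> p <= p' -> p' <= 1 ->
  binom_lt N l p' <= binom_lt N l p.
Proof.
move=> p0 pp p1; elim: N l => [|N IH] l //=.
have := IH l; have := IH l.-1.
have /(binom_lt_step_mono N l) : 0 <= p' <= 1 by rewrite p1 (le_trans p0).
by nra.
Qed.

Lemma binom_lt_succ_ge N l p : 0 <= p <= 1 ->
  (1 - p) * binom_lt N l p <= binom_lt N.+1 l p.
Proof.
by move=> p01; rewrite /= lerDl mulr_ge0 ?binom_lt_ge0//; case/andP: p01.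
Qed.

Lemma binom_lt_anti_size N M l p : 0 <= p <= 1 -> (N <= M)%N ->
  binom_lt M l p <= binom_lt N l p.
Proof.
move=> p01; elim: M => [|M IH]; first by rewrite leqn0 => /eqP->.
rewrite leq_eqVlt => /predU1P[->//|/IH]; apply: le_trans => /=.
by have := binom_lt_step_mono M l p01; case/andP: p01; nra.
Qed.

Lemma binom_lt1 N p : binom_lt N 1 p = (1 - p) ^+ N.
Proof. by elim: N => //= N ->; rewrite binom_lt0 mulr0 addr0 exprS. Qed.

(** Markov's inequality for [z ^+ S], where [S] is the binomial variable. *)
Lemma binom_lt_chernoff N l p z : 0 <= p <= 1 -> 1 <= z ->
  1 - binom_lt N l p <= (1 - p + p * z) ^+ N / z ^+ l.
Proof.
move=> /andP[p0 p1] z1; have z0 : 0 < z by exact: lt_le_trans z1.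
have m1 : 1 <= 1 - p + p * z by nra.
elim: N l => [|N IH] l.
  case: l => [|l] /=; rewrite ?subr0 ?expr0 ?divr1// subrr.
  by rewrite mulr_ge0// invr_ge0 exprn_ge0// ltW.
case: l => [|l].
  by rewrite binom_lt0 subr0 expr0 divr1 exprn_ege1.
have -> : 1 - binom_lt N.+1 l.+1 p =
  (1 - p) * (1 - binom_lt N l.+1 p) + p * (1 - binom_lt N l p).
  by rewrite /=; ring.
have -> : (1 - p + p * z) ^+ N.+1 / z ^+ l.+1 =
  (1 - p) * ((1 - p + p * z) ^+ N / z ^+ l.+1)
    + p * ((1 - p + p * z) ^+ N / z ^+ l).
  by rewrite !exprS; field; rewrite expf_neq0 gt_eqF.
by rewrite lerD// ler_wpM2l// subr_ge0.
Qed.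

Lemma binom_lt_ge_bin N l p : 0 <= p <= 1 ->
  'C(N, l)%:R * p ^+ l * (1 - p) ^+ N <= binom_lt N l.+1 p.
Proof.
move=> p01; have /andP[p0 p1] := p01; have q0 : 0 <= 1 - p by rewrite subr_ge0.
elim: N l => [|N IH] [|l].
- by rewrite bin0 !expr0 !mulr1.
- by rewrite bin0n/= mul0r mul0r.
- by rewrite binom_lt1 bin0 expr0 !mul1r.
rewrite binS natrD/=.
have := IH l.+1; have := IH l.
set u := _ * _; set v := _ * _ * _ => uB vB.
apply: (@le_trans _ _ ((1 - p) * v + p * u)); last first.
  by rewrite lerD// ler_wpM2l.
have u0 : 0 <= u by rewrite !mulr_ge0// exprn_ge0.
rewrite /u /v !exprS; set e := (1 - p) ^+ N.
have e0 : 0 <= e by exact: exprn_ge0.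
rewrite -subr_ge0; set w := (X in 0 <= X).
suff -> : w = p * (p * ('C(N, l)%:R * p ^+ l * e)) by rewrite !mulr_ge0// exprn_ge0.
by rewrite /w; ring.
Qed.

Lemma trinom_lt_snd0 N l p : trinom_lt N l 1 p 0 = binom_lt N l p.
Proof.
elim: N l => [|N IH] l /=; first by rewrite andbT.
by rewrite !IH mul0r addr0 subr0.
Qed.

(** Negative dependence: two exclusive outcomes compete for the same trials. *)
Lemma trinom_lt_le N l1 l2 p q : 0 <= p -> 0 <= q -> p + q <= 1 ->
  trinom_lt N l1 l2 p q <= binom_lt N l1 p * binom_lt N l2 q.
Proof.
move=> p0 q0 pq; elim: N l1 l2 => [|N IH] l1 l2 /=.
  by case: (0 < l1)%N; case: (0 < l2)%N; rewrite ?mulr1 ?mulr0.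
have pr0 : 0 <= 1 - p - q by rewrite -addrA -opprD subr_ge0.
have := binom_lt_step_mono N l1 (_ : 0 <= p <= 1).
have := binom_lt_step_mono N l2 (_ : 0 <= q <= 1).
rewrite p0 q0 /= => /(_ _)h2 /(_ _)h1.
have {}h1 : binom_lt N l1.-1 p <= binom_lt N l1 p by apply: h1; lra.
have {}h2 : binom_lt N l2.-1 q <= binom_lt N l2 q by apply: h2; lra.
apply: (@le_trans _ _ ((1 - p - q) * (binom_lt N l1 p * binom_lt N l2 q) +
  p * (binom_lt N l1.-1 p * binom_lt N l2 q) +
  q * (binom_lt N l1 p * binom_lt N l2.-1 q))).
  by rewrite !lerD// ler_wpM2l.
rewrite -subr_ge0; set w := (X in 0 <= X).
suff -> : w = p * q * ((binom_lt N l1 p - binom_lt N l1.-1 p) *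
   (binom_lt N l2 q - binom_lt N l2.-1 q)).
  by rewrite !mulr_ge0// subr_ge0.
by rewrite /w; ring.
Qed.

End binom_lt.

(** * The second moment method *)

Section second_moment.
Context {R : realType} {dO : measure_display} {Omega : measurableType dO}
  {P : probability Omega R}.

Lemma probabilityE (B : set Omega) : measurable B -> P B = (fine (P B))%:E.
Proof. by move=> mB; rewrite fineK// fin_num_measure. Qed.

Lemma integral_weighted_indic (I : finType) (c : I -> R) (A : I -> set Omega) :
  (forall i, 0 <= c i) -> (forall i, measurable (A i)) ->
  (\int[P]_w (\sum_i c i * \1_(A i) w)%:E)%E = (\sum_i c i * fine (P (A i)))%:E.
Proof.
move=> c0 mA; under eq_integral do rewrite -sumEFin.
rewrite ge0_integral_sum//=.
- rewrite -sumEFin; apply: eq_bigr => i _.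
  under eq_integral do rewrite EFinM.
  rewrite ge0_integralZl_EFin//; last first.
    by apply/measurable_EFinP; exact: measurable_indic.
  by rewrite integral_indic// setIT EFinM -probabilityE.
- move=> i; apply/measurable_EFinP; apply: measurable_funM.
    exact: measurable_cst.
  exact: measurable_indic.
- by move=> i w _; rewrite lee_fin mulr_ge0.
Qed.

Lemma weighted_prob_le (I J : finType) (c : I -> R) (A : I -> set Omega)
    (e : J -> R) (B : J -> set Omega) :
  (forall i, 0 <= c i) -> (forall i, measurable (A i)) ->
  (forall j, 0 <= e j) -> (forall j, measurable (B j)) ->
  (forall w, \sum_i c i * \1_(A i) w <= \sum_j e j * \1_(B j) w) ->
  \sum_i c i * fine (P (A i)) <= \sum_j e j * fine (P (B j)).
Proof.
move=> c0 mA e0 mB AB; rewrite -lee_fin -!integral_weighted_indic//.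
have mf (K : finType) (f : K -> R) (D : K -> set Omega) : (forall i, measurable (D i)) ->
    measurable_fun setT (fun w => (\sum_i f i * \1_(D i) w)%:E).
  move=> mD; apply/measurable_EFinP; apply: measurable_sum => i.
  by apply: measurable_funM; [exact: measurable_cst|exact: measurable_indic].
apply: ge0_le_integral => //; try exact: mf.
  by move=> w _; rewrite lee_fin sumr_ge0// => i _; rewrite mulr_ge0.
by move=> w _; rewrite lee_fin.
Qed.

(** Chebyshev's inequality for the number [W] of events that occur: the first
    sum is the mean [M] of [W] and the double sum its second moment. It is the
    integral of [M ^+ 2 * \1_Z + 2 * M * W <= W ^+ 2 + M ^+ 2]. *)
Lemma prob_none_le (I : finType) (A : I -> set Omega) (Z : set Omega) :
  (forall i, measurable (A i)) -> measurable Z ->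
  (forall w, Z w -> forall i, ~ A i w) ->
  (\sum_i fine (P (A i))) ^+ 2 * fine (P Z) <=
  \sum_i \sum_j fine (P (A i `&` A j)) - (\sum_i fine (P (A i))) ^+ 2.
Proof.
move=> mA mZ ZA; set M := \sum_i fine (P (A i)).
have M0 : 0 <= M by rewrite sumr_ge0// => i _; rewrite fine_ge0.
pose c (o : option I) : R := if o is Some _ then 2 * M else M ^+ 2.
pose AZ (o : option I) := if o is Some i then A i else Z.
pose e (o : option (I * I)) : R := if o is Some _ then 1 else M ^+ 2.
pose B (o : option (I * I)) := if o is Some ij then A ij.1 `&` A ij.2 else setT.
have := @weighted_prob_le _ _ c AZ e B.
have bigo (K : finType) (f : option K -> R) : \sum_o f o = f None + \sum_k f (Some k).
  rewrite (bigD1 None)//=; congr (_ + _).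
  rewrite (reindex_omap (@Some K) id)//=; last by case.
  by apply: eq_bigl => k; rewrite eqxx.
rewrite !bigo /= -big_distrr/= -/M probability_setT mulr1 -[in X in _ -> X]lerBlDr.
have -> : \sum_(k : I * I) 1 * fine (P (A k.1 `&` A k.2)) =
    \sum_i \sum_j fine (P (A i `&` A j)).
  by rewrite pair_bigA; apply: eq_bigr => k _; rewrite mul1r.
move=> h; suff : M ^+ 2 * fine (P Z) + 2 * M * M <=
  M ^+ 2 + \sum_i \sum_j fine (P (A i `&` A j)) by lra.
apply: h.
- by case=> [i|]; rewrite /c ?sqr_ge0// mulr_ge0.
- by case.
- by case=> [i|]; rewrite /e ?sqr_ge0.
- by case=> [i|]//=; exact: measurableI.
move=> w; rewrite !bigo /= -big_distrr/= indicT mulr1.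
set W := \sum_i \1_(A i) w.
have -> : \sum_(k : I * I) 1 * \1_(A k.1 `&` A k.2) w = W ^+ 2 :> R.
  rewrite expr2 /W big_distrlr/= pair_bigA; apply: eq_bigr => k _.
  by rewrite mul1r indicI.
have [Zw|nZw] := pselect (Z w).
  suff -> : W = 0 by rewrite mulr0 addr0 expr0n/= addr0 ler_piMr ?sqr_ge0.
  by rewrite /W big1// => i _; rewrite indicE memNset//; exact: ZA.
rewrite indicE memNset// mulr0 add0r.
by have := sqr_ge0 (M - W); nra.
Qed.

End second_moment.

(** * The law of an independent sample *)

Section sample.
Context {R : realType} {dO dT : measure_display} {Omega : measurableType dO}
  {T : measurableType dT} {P : probability Omega R} (mu : probability T R)
  (X : nat -> {RV P >-> T}) (Xindep : mutually_independent X)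
  (Xlaw : forall i B, measurable B -> distribution P (X i) B = mu B).

Definition hits (s : seq nat) (C : set T) (w : Omega) : nat :=
  count (fun i => X i w \in C) s.

Lemma measurable_preimage_sample i B : measurable B -> measurable (X i @^-1` B).
Proof. by move=> mB; rewrite -[_ @^-1` _]setTI; exact: measurable_funP. Qed.

Lemma hits_cons_lt i s C l w :
  (hits (i :: s) C w < l)%N =
  (if X i w \in C then hits s C w < l.-1 else hits s C w < l)%N.
Proof. by rewrite /hits /=; case: (_ \in _); case: l. Qed.

Lemma measurable_hits_lt s C l : measurable C ->
  measurable [set w | (hits s C w < l)%N].
Proof.
move=> mC; elim: s l => [|i s IH] l.
  case: l => [|l]; first by rewrite [X in measurable X](_ : _ = set0)//; apply/seteqP; split.
  by rewrite [X in measurable X](_ : _ = setT)//; apply/seteqP; split.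
rewrite [X in measurable X](_ : _ =
    (X i @^-1` C `&` [set w | (hits s C w < l.-1)%N]) `|`
    (X i @^-1` (~` C) `&` [set w | (hits s C w < l)%N])).
  by apply: measurableU; apply: measurableI => //;
     apply: measurable_preimage_sample => //; exact: measurableC.
apply/seteqP; split => w /=; rewrite hits_cons_lt.
  by case: ifPn => [/set_mem|/negP Cw]; [left|right; split=> // /mem_set].
case=> -[Cw]; first by rewrite mem_set.
by rewrite memNset.
Qed.

Let m (B : set T) : R := fine (mu B).


(** The points with index in [J] have prescribed locations, those with index in
    [s] are free and are only counted. *)
Definition sample_event (J : {fset nat}) (D : nat -> set T) (s : seq nat)
    (C1 C2 : set T) (l1 l2 : nat) : set Omega :=
  (\bigcap_(j in [set` J]) X j @^-1` D j) `&`
  ([set w | (hits s C1 w < l1)%N] `&` [set w | (hits s C2 w < l2)%N]).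

Lemma measurable_sample_event J D s C1 C2 l1 l2 :
  (forall j, measurable (D j)) -> measurable C1 -> measurable C2 ->
  measurable (sample_event J D s C1 C2 l1 l2).
Proof.
move=> mD mC1 mC2; apply: measurableI.
  by apply: bigcap_measurableType => j _; exact: measurable_preimage_sample.
by apply: measurableI; exact: measurable_hits_lt.
Qed.

Let upd (D : nat -> set T) i B j := if j == i then B else D j.

Let bigcap_fsetU1 J D i B : i \notin J ->
  \bigcap_(j in [set` (i |` J)%fset]) X j @^-1` (upd D i B j) =
  X i @^-1` B `&` \bigcap_(j in [set` J]) X j @^-1` D j.
Proof.
move=> iJ; apply/seteqP; split => w.
  move=> h; split; first by have := h i; rewrite /upd eqxx; apply => /=; rewrite fset1U1.
  move=> j /= jJ; have := h j; rewrite /upd; case: eqP => [ji|_]; first by rewrite -ji jJ in iJ.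
  by apply => /=; rewrite in_fsetU jJ orbT.
move=> [hi h] j /=; rewrite in_fsetU in_fset1 /upd; case: eqP => [-> _//|_ /= jJ].
exact: h.
Qed.

(** Conditioning on the first of the free sample points leads from [s] to its
    tail, with one more prescribed location; it reproduces the recursion that
    defines [trinom_lt]. *)
Lemma sample_event_law J D s C1 C2 l1 l2 :
  (forall j, measurable (D j)) -> measurable C1 -> measurable C2 ->
  C1 `&` C2 = set0 -> uniq s -> {in s, forall i, i \notin J} ->
  P (sample_event J D s C1 C2 l1 l2) =
  ((\prod_(j <- J) m (D j)) * trinom_lt (size s) l1 l2 (m C1) (m C2))%:E.
Proof.
move=> + mC1 mC2 C12.
have mE B : measurable B -> mu B = (m B)%:E.
  by move=> mB; rewrite fineK// fin_num_measure.
have mC3 : measurable (~` (C1 `|` C2)) by apply: measurableC; exact: measurableU.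
have m3 : m (~` (C1 `|` C2)) = 1 - m C1 - m C2.
  have mU : mu (C1 `|` C2) = (m C1 + m C2)%:E.
    by rewrite measureU// EFinD; congr (_ + _)%E; exact: mE.
  by rewrite /m probability_setC; [rewrite mU -EFinB/= opprD addrA|exact: measurableU].
elim: s J D l1 l2 => [|i s IH] J D l1 l2 mD /=.
  move=> _ _; rewrite /sample_event /=.
  case: (posnP l1) => [_|l1p]; last case: (posnP l2) => [_|l2p] /=.
  - rewrite mulr0 [X in P X](_ : _ = set0) ?measure0//.
    by apply/seteqP; split => // w [_ []].
  - rewrite mulr0 [X in P X](_ : _ = set0) ?measure0//.
    by apply/seteqP; split => // w [_ []].
  rewrite [X in P X](_ : _ = \bigcap_(j in [set` J]) X j @^-1` D j); last first.
    by apply/seteqP; split => [w []//|w h]; split.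
  rewrite Xindep// mulr1 -prodEFin; apply: eq_bigr => j _.
  by rewrite -mE// -(Xlaw j).
move=> /andP[iNs us] sJ.
have iJ : i \notin J by rewrite sJ// mem_head.
have mU B : measurable B -> forall j, measurable (upd D i B j).
  by move=> mB j; rewrite /upd; case: ifP.
have sJ' : {in s, forall j, j \notin (i |` J)%fset}.
  move=> j js; rewrite in_fsetU in_fset1 negb_or sJ ?inE ?js ?orbT// andbT.
  by apply: contraNneq iNs => <-.
have pU B : \prod_(j <- (i |` J)%fset) m (upd D i B j) = m B * \prod_(j <- J) m (D j).
  rewrite big_fsetU1//= {1}/upd eqxx; congr (_ * _).
  rewrite big_seq [RHS]big_seq; apply: eq_bigr => j jJ.
  by rewrite /upd; case: eqP => // ji; rewrite -ji jJ in iJ.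
pose E B l l' := sample_event (i |` J)%fset (upd D i B) s C1 C2 l l'.
have EE B l l' w : E B l l' w <-> B (X i w) /\ sample_event J D s C1 C2 l l' w.
  rewrite /E /sample_event bigcap_fsetU1//.
  by split=> [[[]]|[? []]].
have PE B l l' : measurable B -> P (E B l l') =
    (m B * (\prod_(j <- J) m (D j)) * trinom_lt (size s) l l' (m C1) (m C2))%:E.
  by move=> mB; rewrite IH// ?pU//; exact: mU.
have no12 w : C1 (X i w) -> C2 (X i w) -> False.
  by move=> c1 c2; suff : set0 (X i w) by []; rewrite -C12.
rewrite [X in P X](_ : _ =
    E (~` (C1 `|` C2)) l1 l2 `|` (E C1 l1.-1 l2 `|` E C2 l1 l2.-1)); last first.
  apply/seteqP; split => w.
    move=> [wJ []] /=; rewrite !hits_cons_lt => h1 h2.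
    have [C1w|NC1w] := boolP (X i w \in C1).
      right; left; apply/EE; split; first exact: set_mem.
      split=> //; move: h1 h2; rewrite C1w /= ifF//; apply/negbTE/negP => C2w.
      by apply: (no12 w); exact: set_mem.
    rewrite (negbTE NC1w) in h1.
    have [C2w|NC2w] := boolP (X i w \in C2).
      right; right; apply/EE; split; first exact: set_mem.
      by rewrite C2w in h2; split.
    left; apply/EE; rewrite (negbTE NC2w) in h2.
    by split => //; case => /mem_set; exact/negP.
  case=> [/EE[Cw [wJ [h1 h2]]]|[|]/EE[Cw [wJ [h1 h2]]]]; split => //; split => /=;
    rewrite hits_cons_lt.
  - by rewrite memNset// => c; apply: Cw; left.
  - by rewrite memNset// => c; apply: Cw; right.
  - by rewrite mem_set.
  - by rewrite memNset// => /(no12 _ Cw).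
  - by rewrite memNset// => /(no12 w)/(_ Cw).
  - by rewrite mem_set.
have mEE B l l' : measurable B -> measurable (E B l l').
  by move=> mB; apply: measurable_sample_event => //; exact: mU.
transitivity (P (E (~` (C1 `|` C2)) l1 l2) +
    (P (E C1 l1.-1 l2) + P (E C2 l1 l2.-1)))%E; last first.
  by rewrite !PE// m3 -!EFinD; congr EFin; ring.
rewrite measureU; first (rewrite measureU//; try exact: mEE).
- apply/seteqP; split => // w [/EE[c1 _] /EE[c2 _]].
  exact: (no12 w).
- exact: mEE.
- by apply: measurableU; exact: mEE.
- by apply/seteqP; split => // w [/EE[c3 _] [|] /EE[c _]]; apply: c3; [left|right].
Qed.

Let mE B : measurable B -> mu B = (m B)%:E.
Proof. by move=> mB; rewrite fineK// fin_num_measure. Qed.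

Let m_ge0 B : 0 <= m B.
Proof. by rewrite fine_ge0. Qed.

Let m_01 B : measurable B -> 0 <= m B <= 1.
Proof. by move=> mB; rewrite m_ge0 -lee_fin -mE//; exact: probability_le1. Qed.

Let m_set0 : m set0 = 0.
Proof. by rewrite /m measure0. Qed.

Let hits_set0 s w : hits s set0 w = 0%N.
Proof.
rewrite /hits; apply/eqP; rewrite -leqn0 leqNgt -has_count; apply/hasPn => i _.
by rewrite in_set0.
Qed.

Lemma hits_lt_law s C l : measurable C -> uniq s ->
  P [set w | (hits s C w < l)%N] = (binom_lt (size s) l (m C))%:E.
Proof.
move=> mC us.
rewrite [X in P X](_ : _ = sample_event fset0 (fun=> setT) s C set0 l 1); last first.
  apply/seteqP; split => w; last by case=> _ [].
  by move=> h; split=> //; split => //=; rewrite hits_set0.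
rewrite sample_event_law ?setI0// big_seq_fset0 mul1r m_set0.
by rewrite trinom_lt_snd0.
Qed.

Lemma hits_lt_law1 t B s C l : measurable B -> measurable C ->
  uniq (t :: s) ->
  P (X t @^-1` B `&` [set w | (hits s C w < l)%N]) =
  (m B * binom_lt (size s) l (m C))%:E.
Proof.
move=> mB mC /= /andP[ts us].
rewrite [X in P X](_ : _ = sample_event [fset t]%fset (fun=> B) s C set0 l 1); last first.
  apply/seteqP; split => w.
    move=> [h1 h2]; split; first by move=> j /=; rewrite in_fset1 => /eqP ->.
    by split => //=; rewrite hits_set0.
  by move=> [h1 [h2 _]]; split => //; apply: (h1 t); rewrite /= in_fset1.
rewrite sample_event_law ?setI0//.
  by rewrite big_seq_fset1 m_set0 trinom_lt_snd0.
by move=> i si; rewrite in_fset1; apply: contraNneq ts => <-.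
Qed.

Lemma hits_lt_law2 t t' B B' s C C' l l' : measurable B -> measurable B' ->
  measurable C -> measurable C' -> C `&` C' = set0 -> uniq [:: t, t' & s] ->
  P ((X t @^-1` B `&` X t' @^-1` B') `&`
     ([set w | (hits s C w < l)%N] `&` [set w | (hits s C' w < l')%N])) =
  (m B * m B' * trinom_lt (size s) l l' (m C) (m C'))%:E.
Proof.
move=> mB mB' mC mC' CC' /= /and3P[ts t's us].
have tt' : t != t' by move: ts; rewrite inE negb_or => /andP[].
have {}ts : t \notin s by move: ts; rewrite inE negb_or => /andP[].
pose D j := if j == t then B else B'.
rewrite [X in P X](_ : _ = sample_event [fset t; t']%fset D s C C' l l'); last first.
  apply/seteqP; split => w.
    move=> [[h1 h1'] h2]; split => // j /=; rewrite in_fset2 /D.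
    by case: eqP => [->//|_ /= /eqP->].
  move=> [h1 h2]; split=> //; split.
    by have := h1 t; rewrite /= in_fset2 eqxx /D eqxx; apply.
  by have := h1 t'; rewrite /= in_fset2 eqxx orbT /D eq_sym (negbTE tt'); apply.
rewrite sample_event_law//.
- rewrite big_fsetU1 ?in_fset1//= big_seq_fset1 /D eqxx.
  by rewrite eq_sym (negbTE tt').
- by move=> j; rewrite /D; case: ifP.
by move=> i si; rewrite in_fset2; apply/norP; split;
  [apply: contraNneq ts => <-|apply: contraNneq t's => <-].
Qed.

(** One ball with few sample points on average: Chernoff's bound controls the
    event that it contains more than [kappa] points, and [(1 - m B) ^+ n0] is the
    probability that none of the first [n0] points falls into the core [B]. *)
Lemma one_ball (B C : set T) (n0 N kappa : nat) (z : R) :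
  measurable B -> measurable C -> 1 <= z ->
  exists Bad, [/\ measurable Bad,
    (P Bad <= ((1 - m B) ^+ n0 + (1 - m C + m C * z) ^+ N / z ^+ kappa.+1)%:E)%E &
    forall w, ~ Bad w -> exists2 t, (t < n0)%N &
      B (X t w) /\ (hits (iota 0 N) C w <= kappa)%N].
Proof.
move=> mB mC z1.
pose E1 := [set w | (hits (iota 0 n0) B w < 1)%N].
pose E2 := [set w | (hits (iota 0 N) C w < kappa.+1)%N].
have mE1 : measurable E1 by exact: measurable_hits_lt.
have mE2 : measurable E2 by exact: measurable_hits_lt.
exists (E1 `|` ~` E2); split.
- by apply: measurableU => //; exact: measurableC.
- apply: (@le_trans _ _ (P E1 + P (~` E2))%E).
    by apply: measureU2 => //; exact: measurableC.
  rewrite probability_setC// !hits_lt_law ?iota_uniq// !size_iota binom_lt1.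
  rewrite -EFinB -EFinD lee_fin lerD2l.
  by apply: binom_lt_chernoff => //; exact: m_01.
move=> w /not_orP[/= h1 /contrapT h2].
have : has (fun i => X i w \in B) (iota 0 n0).
  by rewrite has_count lt0n; apply/negP => /eqP h; apply: h1; rewrite /E1 /= /hits h.
move=> /hasP[t]; rewrite mem_iota/= add0n => tn /set_mem Bt.
by exists t.
Qed.

Lemma hits_rem_le t s C w : (hits (rem t s) C w <= hits s C w)%N.
Proof. by rewrite /hits count_rem leq_subr. Qed.

Lemma hits_le_rem t s C w : (hits s C w <= (hits (rem t s) C w).+1)%N.
Proof. by rewrite /hits count_rem; case: (_ && _) => /=; lia. Qed.

(** The number of pairs of a ball [C i] and a sample point in its core [B i], the
    ball having fewer than [kappa] other sample points, has mean [M]. In its second moment,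
    pairs with different balls are negatively dependent, up to the factor
    [(1 - p) ^- 2] that accounts for the two prescribed points, and distinct pairs
    with the same ball add at most [M * (n0%:R * p / (1 - p))]. *)
Lemma many_balls (I : finType) (B C : I -> set T) (n0 N kappa : nat) (p : R) :
  (forall i, measurable (B i)) -> (forall i, measurable (C i)) ->
  (forall i, B i `<=` C i) -> trivIset setT C ->
  (forall i, m (C i) <= p) -> 0 <= p < 1 -> (n0 <= N)%N ->
  let M := \sum_i n0%:R * (m (B i) * binom_lt N.-1 kappa (m (C i))) in
  exists Bad, [/\ measurable Bad,
    M ^+ 2 * fine (P Bad) <=
      M * (1 + n0%:R * p / (1 - p)) + M ^+ 2 * ((1 - p) ^- 2 - 1) &
    forall w, ~ Bad w -> exists i, exists2 t, (t < n0)%N &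
      B i (X t w) /\ (hits (iota 0 N) (C i) w <= kappa)%N].
Proof.
move=> mB mC BC trC Cp /andP[p0 p1] n0N M.
pose A (a : I * 'I_n0) : set Omega := X a.2 @^-1` B a.1 `&`
  [set w | (hits (rem (a.2 : nat) (iota 0 N)) (C a.1) w < kappa)%N].
have mA a : measurable (A a).
  apply: measurableI; first exact: measurable_preimage_sample.
  exact: measurable_hits_lt.
pose f (a : I * 'I_n0) := m (B a.1) * binom_lt N.-1 kappa (m (C a.1)).
have tN (t : 'I_n0) : (t : nat) \in iota 0 N.
  by rewrite mem_iota/= add0n (leq_trans (ltn_ord t)).
have PA (a : I * 'I_n0) : fine (P (A a)) = f a.
  rewrite hits_lt_law1//=.
    by rewrite size_rem ?tN// size_iota.
  by rewrite mem_rem_uniq ?iota_uniq// inE eqxx/= rem_uniq// iota_uniq.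
have C01 (i : I) : 0 <= m (C i) <= 1 by exact: m_01.
have BCm (i : I) : m (B i) <= m (C i).
  rewrite -lee_fin -!mE//; apply: le_measure; rewrite ?inE//; exact: BC.
have f0 a : 0 <= f a by rewrite mulr_ge0// binom_lt_ge0.
have q0 : 0 < 1 - p by rewrite subr_gt0.
pose Bad := \bigcap_(a in [set: I * 'I_n0]) ~` A a.
have mBad : measurable Bad.
  by apply: fin_bigcap_measurable => [|a _]; [exact: finite_finset|exact: measurableC].
have SM : \sum_a f a = M.
  rewrite /M -(pair_bigA _ (fun i (_ : 'I_n0) => m (B i) * binom_lt N.-1 kappa (m (C i))))/=.
  by apply: eq_bigr => i _; rewrite sumr_const card_ord mulr_natl.
have F2 i : binom_lt N.-2 kappa (m (C i)) <= binom_lt N.-1 kappa (m (C i)) / (1 - p).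
  case: N {n0N tN PA mA A Bad mBad SM f f0} M => [|[|N]] _ /=.
  - by rewrite ler_pdivlMr// ler_piMr ?binom_lt_ge0// lerBlDr lerDl.
  - by rewrite ler_pdivlMr// ler_piMr ?binom_lt_ge0// lerBlDr lerDl.
  rewrite ler_pdivlMr// mulrC; apply: le_trans (binom_lt_succ_ge _ _ _) => //.
  by rewrite ler_wpM2r ?binom_lt_ge0// lerB.
have Fi0 i : 0 <= binom_lt N.-2 kappa (m (C i)) by exact: binom_lt_ge0.
have PAA (a b : I * 'I_n0) : fine (P (A a `&` A b)) <=
    (a == b)%:R * f a + (a.1 == b.1)%:R * (m (B a.1) * f a / (1 - p))
    + f a * f b / (1 - p) ^+ 2.
  have pos1 : 0 <= m (B a.1) * f a / (1 - p) by apply: divr_ge0; [exact: mulr_ge0|exact: ltW].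
  have pos2 c : 0 <= f a * f c / (1 - p) ^+ 2 by apply: divr_ge0; [exact: mulr_ge0|exact: sqr_ge0].
  have [<-|ab] := eqVneq a b.

    rewrite setIid PA eqxx /= !mul1r -addrA lerDl; exact: addr_ge0.
  rewrite /= mulr0n mul0r add0r.
  have [tt|tt] := eqVneq (a.2 : nat) b.2.
    rewrite [X in P X](_ : _ = set0) ?measure0/=.
      by rewrite addr_ge0// mulr_ge0.
    apply/seteqP; split => // w [[/BC h1 _] [/BC h2 _]].
    have : a.1 = b.1 by apply: trC => //; exists (X a.2 w); split => //=; rewrite tt.
    move=> e; case/eqP: ab; case: (a) (b) e tt => [i t] [j t'] /= -> tt.
    by congr pair; exact: val_inj.
  set s := rem (b.2 : nat) (rem (a.2 : nat) (iota 0 N)).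
  have sE : s = rem (a.2 : nat) (rem (b.2 : nat) (iota 0 N)).
    rewrite /s !rem_filter ?filter_uniq ?iota_uniq// -!filter_predI.
    by apply: eq_filter => x /=; rewrite andbC.
  have us : uniq [:: (a.2 : nat), (b.2 : nat) & s].
    rewrite /= inE negb_or tt /s mem_rem_uniq ?rem_uniq ?iota_uniq// !inE.
    by rewrite/= !mem_rem_uniq ?rem_uniq ?iota_uniq// !inE !eqxx/= andbF.
  have ss : size s = N.-2.
    by rewrite size_rem ?size_rem ?tN ?size_iota// mem_rem_uniq ?iota_uniq// !inE eq_sym tt tN.
  have [ij|ij] /= := eqVneq a.1 b.1.
    rewrite mul1r; apply: (@le_trans _ _ (m (B a.1) * f a / (1 - p))); last by rewrite lerDl.
    apply: (@le_trans _ _ (m (B a.1) * m (B a.1) * binom_lt N.-2 kappa (m (C a.1)))); last first.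
      by rewrite /f !mulrA -[leRHS]mulrA ler_wpM2l ?mulr_ge0.
    have := @hits_lt_law2 a.2 b.2 (B a.1) (B a.1) s (C a.1) set0 kappa 1 (mB _) (mB _) (mC _)
      measurable0 (setI0 _) us.
    rewrite ss m_set0 trinom_lt_snd0 => e.
    rewrite -lee_fin -e -probabilityE; last exact: measurableI.
    apply: le_measure; rewrite ?inE.
    - exact: measurableI.
    - apply: measurableI; last by apply: measurableI; exact: measurable_hits_lt.
      by apply: measurableI; exact: measurable_preimage_sample.
    move=> w [[h1 h2] [h3 h4]]; split; first by split => //=; rewrite ij.
    split => /=; last by rewrite hits_set0.
    by apply: leq_ltn_trans h2; exact: hits_rem_le.
  rewrite mulr0n mul0r add0r.
  have Cij : C a.1 `&` C b.1 = set0.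
    by move/trivIsetP : trC; apply.
  have := hits_lt_law2 kappa kappa (mB a.1) (mB b.1) (mC a.1) (mC b.1) Cij us.
  rewrite ss => e.
  apply: (@le_trans _ _ (m (B a.1) * m (B b.1) * trinom_lt N.-2 kappa kappa (m (C a.1)) (m (C b.1)))).
    rewrite -lee_fin -e -probabilityE; last exact: measurableI.
    apply: le_measure; rewrite ?inE.
    - exact: measurableI.
    - apply: measurableI; last by apply: measurableI; exact: measurable_hits_lt.
      by apply: measurableI; exact: measurable_preimage_sample.
    move=> w [[h1 h2] [h3 h4]]; split => //.
    split => /=; first by apply: leq_ltn_trans h2; exact: hits_rem_le.
    by rewrite sE; apply: leq_ltn_trans h4; exact: hits_rem_le.
  have sum1 : m (C a.1) + m (C b.1) <= 1.
    rewrite -lee_fin EFinD -!mE// -measureU//.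
    by apply: probability_le1; exact: measurableU.
  apply: (@le_trans _ _ (m (B a.1) * m (B b.1) *
      (binom_lt N.-2 kappa (m (C a.1)) * binom_lt N.-2 kappa (m (C b.1))))).
    by rewrite ler_wpM2l ?mulr_ge0// trinom_lt_le.
  rewrite [leRHS](_ : _ = m (B a.1) * m (B b.1) *
    ((binom_lt N.-1 kappa (m (C a.1)) / (1 - p)) * (binom_lt N.-1 kappa (m (C b.1)) / (1 - p)))).
    by rewrite ler_wpM2l ?mulr_ge0// ler_pM.
  by rewrite /f; field; rewrite gt_eqF.
exists Bad; split => //.
  have ZA w : Bad w -> forall i, ~ A i w by move=> h i; exact: h.
  have := prob_none_le (P := P) mA mBad ZA.
  have -> : \sum_a fine (P (A a)) = M by rewrite -SM; apply: eq_bigr => a _; exact: PA.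
  move=> /le_trans; apply.
  rewrite mulrBr mulr1 addrA lerD2r.
  apply: (@le_trans _ _ (\sum_a (f a + n0%:R * (m (B a.1) * f a / (1 - p)) + f a * M / (1 - p) ^+ 2))).
    apply: ler_sum => a _.
    apply: (le_trans (ler_sum _ (fun b _ => PAA a b))).
    rewrite !big_split/= lerD//; last first.
      by rewrite -mulr_suml -mulr_sumr SM.
    rewrite lerD//.
      rewrite (bigD1 a)//= eqxx mul1r big1 ?addr0// => b ba.
      by rewrite eq_sym (negbTE ba) mul0r.
    rewrite -mulr_suml ler_wpM2r//.
      by apply: divr_ge0; [exact: mulr_ge0|exact: ltW].
    rewrite -(pair_bigA _ (fun i (_ : 'I_n0) => (a.1 == i)%:R))/=.
    rewrite (bigD1 a.1)//= [X in _ + X]big1 => [|i ia]; last first.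
      by rewrite big1// => ? _; rewrite eq_sym (negbTE ia).
    by rewrite addr0 sumr_const card_ord eqxx.
  rewrite !big_split/= SM -addrA mulrDr mulr1 -[leRHS]addrA lerD2l lerD//; last first.
    by rewrite -!mulr_suml SM -expr2.
  apply: (@le_trans _ _ (\sum_a f a * (n0%:R * p / (1 - p)))); last by rewrite -mulr_suml SM.
  apply: ler_sum => a _.
  rewrite [leLHS](_ : _ = f a * (n0%:R * m (B a.1) / (1 - p))); last by ring.
  by rewrite ler_wpM2l// ler_wpM2r ?invr_ge0 ?(ltW q0)// ler_wpM2l// (le_trans (BCm _)).
move=> w /existsNP[a /not_implyP[_ /contrapT [h1 h2]]].
exists a.1; exists a.2 => //; split => //.
by apply: leq_trans (hits_le_rem a.2 _ _ _) _.
Qed.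

End sample.

(** * From the sample to the connectivity threshold *)

Section threshold.
Context {R : realType} {A : pointedMetricType R}.

Lemma measurable_cball (x : A) (r : R) :
  measurable (cball x r : set (borelType A)).
Proof.
rewrite -[cball x r]setCK; apply: measurableC; apply: sub_sigma_algebra => /=.
rewrite openE => y /= /negP; rewrite -ltNge => ry.
apply/nbhs_ballP; exists (mdist x y - r); first by rewrite /= subr_gt0.
move=> z; rewrite ballEmdist /= => yz; rewrite /cball /= => xz.
have := metric_triangle x z y; rewrite leNgt => /negP; apply.
by rewrite (metric_sym z); lra.
Qed.

(** A sample point [x t] at distance [r - s] of [c] has its ball of radius [s]
    inside the ball of radius [r] around [c]; if the latter contains at most [k]
    of the points then the threshold is at least [s]. The index bounds allow one
    event to serve for all sample sizes [n] between [n0] and [N]. *)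
Lemma Lnk_ge (x : nat -> A) (n0 N n k t : nat) (c : A) (r s : R) :
  (t < n0)%N -> (n0 <= n <= N)%N -> mdist c (x t) <= r - s ->
  (npoints x N (cball c r) <= k)%N -> (s%:E <= Lnk x n k)%E.
Proof.
move=> tn0 /andP[n0n nN] cxt hk; apply: le_ereal_inf_tmp => _ [s' /= [s0 hs'] <-].
rewrite lee_fin leNgt; apply/negP => s's.
have := hs' (Ordinal (leq_trans tn0 n0n)); rewrite ltnNge => /negP; apply.
apply: leq_trans hk; rewrite /npoints.
rewrite (big_ord_widen _ (fun i => (x i \in cball (x t) s' : nat)) nN) big_mkcond/=.
apply: leq_sum => i _; case: ifP => // _.
case: (boolP (x i \in cball (x t) s')) => // /set_mem xi.
rewrite mem_set//= /cball/=; apply: (le_trans (metric_triangle _ (x t) _)).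
by move: xi; rewrite /cball/=; lra.
Qed.

Lemma packing_near0 (mu : set A -> \bar R) (a d b : R) :
  bigOmega_at0 (fun r : R => packing_number mu r (a * r `^ d)) (fun r => r `^ (- b)) ->
  exists2 c : R, 0 < c & \forall r \near 0^'+, exists (m : nat) (x : 'I_m -> A),
    [/\ c * r `^ (- b) <= m%:R, trivIset setT (fun i => cball (x i) r) &
      forall i, (mu (cball (x i) r) <= (a * r `^ d)%:E)%E].
Proof.
rewrite /bigOmega_at0 limf_einfE => /ereal_sup_gt[_ [V /= V0 <-] hV].
have [c c0 cV] : exists2 c : R, 0 < c &
    (c%:E <= ereal_inf [set packing_number mu r (a * r `^ d) * ((r `^ (- b))^-1)%:E | r in V])%E.
  move: hV; case: (ereal_inf _) => [e| |] //.
    by rewrite lte_fin => e0; exists e.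
  by exists 1 => //; rewrite leey.
exists (c / 2); first by rewrite divr_gt0.
near=> r.
have r0 : 0 < r by near: r; exact: nbhs_right_gt.
have Vr : V r by near: r; exact: V0.
have rb : 0 < r `^ (- b) by rewrite powR_gt0.
have : ((c / 2 * r `^ (- b))%:E < packing_number mu r (a * r `^ d))%E.
  have : (c%:E <= packing_number mu r (a * r `^ d) * ((r `^ (- b))^-1)%:E)%E.
    by apply: (le_trans cV); apply: ereal_inf_lbound; exists r.
  rewrite -(@lee_pmul2r _ (r `^ (- b))%:E)// ?lte_fin// -muleA -!EFinM mulVf ?gt_eqF// mule1.
  by apply: lt_le_trans; rewrite lte_fin ltr_pM2r// ltr_pdivrMr// ltr_pMr// ltr1n.
rewrite /packing_number => /ereal_sup_gt[_ [m [x [trx mux]] <-]].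
rewrite lte_fin => /ltW cm.
by exists m, x.
Unshelve. all: by end_near. Qed.

End threshold.

(** * Almost sure statements *)

Section almost_sure.
Context {R : realType}.

Lemma sum_inv_square_lty : (\sum_(0 <= n <oo) ((n.+1%:R ^- 2 : R)%:E) < +oo)%E.
Proof.
apply: (@le_lt_trans _ _ (2 : R)%:E); last by rewrite ltry.
apply: lime_le; first by apply: is_cvg_nneseries => n _ _; rewrite lee_fin.
apply: nearW => n; rewrite sumEFin lee_fin.
apply: (@le_trans _ _ (2 - 2 / n.+1%:R)); last by rewrite lerBlDr lerDl.
elim: n => [|n IH]; first by rewrite big_geq//; lra.
rewrite big_nat_recr//=; apply: (le_trans (lerD IH (lexx _))).
have : 1 <= n.+1%:R :> R by rewrite ler1n.
rewrite -[n.+2%:R]natr1; move: (n.+1%:R : R) => u u1.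
have u0 : 0 < u by lra.
rewrite -subr_ge0; set v := (X in 0 <= X).
suff -> : v = (u - 1) / (u ^+ 2 * (u + 1)).
  by rewrite divr_ge0 ?mulr_ge0 ?sqr_ge0//; lra.
by rewrite /v; field; rewrite !gt_eqF//; lra.
Qed.

Context {dO : measure_display} {Omega : measurableType dO} (P : probability Omega R).

(** The Borel-Cantelli lemma in terms of measurable supersets of the exceptional
    sets, because [G j] may be an event that is not known to be measurable. *)
Lemma borel_cantelli_near (G : nat -> Omega -> Prop) :
  (\forall j \near \oo, exists Bad, [/\ measurable Bad,
     (P Bad <= (j.+1%:R ^- 2)%:E)%E & forall w, ~ Bad w -> G j w]) ->
  {ae P, forall w, \forall j \near \oo, G j w}.
Proof.
move=> [J _ hJ].
have : forall j, exists Bad, [/\ measurable Bad,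
    (P Bad <= (j.+1%:R ^- 2)%:E)%E & (J <= j)%N -> forall w, ~ Bad w -> G j w].
  move=> j; case: (leqP J j) => Jj.
    by have [Bad [h1 h2 h3]] := hJ j Jj; exists Bad.
  by exists set0; split => //; rewrite measure0 lee_fin.
move=> /choice[Bad hBad].
have mBad j : measurable (Bad j) by case: (hBad j).
exists (lim_sup_set Bad); split.
- by apply: bigcapT_measurable => n; exact: bigcup_measurable.
- apply: lim_sup_set_cvg0 => //; apply: le_lt_trans sum_inv_square_lty.
  by apply: lee_nneseries => // j _; case: (hBad j).
move=> w /= nG n _; apply: contrapT => hn; apply: nG.
exists (maxn n J) => // j /=; rewrite geq_max => /andP[nj Jj].
case: (hBad j) => _ _ /(_ Jj); apply => Bw; apply: hn.
by exists j.
Qed.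

Lemma ae_forall_nat (Q : nat -> Omega -> Prop) :
  (forall i, {ae P, forall w, Q i w}) -> {ae P, forall w, forall i, Q i w}.
Proof.
move=> h; apply: (negligibleS _ (negligible_bigcup h)) => w /= /existsNP[i].
by exists i.
Qed.

Lemma le_limn_einf (u : nat -> \bar R) (l : \bar R) :
  (\forall n \near \oo, (l <= u n)%E) -> (l <= limn_einf u)%E.
Proof.
move=> h; rewrite -[limn_einf u]/(limf_einf u \oo) limf_einfE.
apply: (@le_trans _ _ (ereal_inf (u @` [set n | (l <= u n)%E]))).
  by apply: le_ereal_inf_tmp => _ [n /= ln <-].
by apply: ereal_sup_ubound; exists [set n | (l <= u n)%E].
Qed.

Lemma ae_le_limn_einf (u : Omega -> nat -> \bar R) (l : R) :
  (forall l', l' < l -> {ae P, forall w, \forall n \near \oo, (l'%:E <= u w n)%E}) ->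
  {ae P, forall w, (l%:E <= limn_einf (u w))%E}.
Proof.
move=> h; have := @ae_forall_nat (fun i w => \forall n \near \oo,
  ((l - i.+1%:R^-1)%:E <= u w n)%E).
have hi i : l - i.+1%:R^-1 < l by rewrite ltrBlDr ltrDl.
move=> /(_ (fun i => h _ (hi i))); apply: filterS => w hw.
apply/lee_addgt0Pr => e e0; have [i ie] := ltr_add_invr e0.
rewrite -leeBlDr//; apply: (@le_trans _ _ (l - i.+1%:R^-1)%:E).
  by rewrite -EFinB lee_fin lerB// ltW//; move: ie; rewrite add0r.
exact: le_limn_einf.
Qed.

End almost_sure.

(** * Exponential rates *)

Section rates.
Context {R : realType}.

Lemma linear_le_exp (C e : R) : 0 < e -> \forall x \near +oo, C * x <= expR (e * x).
Proof.
move=> e0; near=> x.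
have x0 : 0 < x by near: x; apply: nbhs_pinfty_gt; exact: num_real.
have xC : 4 * C / e ^+ 2 <= x by near: x; apply: nbhs_pinfty_ge; exact: num_real.
have h : e * x / 2 <= expR (e * x / 2).
  by apply: le_trans (expR_ge1Dx _); rewrite lerDr.
have -> : expR (e * x) = expR (e * x / 2) ^+ 2.
  by rewrite expr2 -expRD; congr expR; field.
have h0 : 0 <= e * x / 2 by rewrite divr_ge0// mulr_ge0// ltW.
apply: (@le_trans _ _ ((e * x / 2) ^+ 2)); last by rewrite ler_sqr ?nnegrE// expR_ge0.
rewrite ler_pdivrMr ?exprn_gt0// in xC.
have : 4 * C * x <= x * e ^+ 2 * x by rewrite ler_wpM2r// ltW.
by nra.
Unshelve. all: by end_near. Qed.

Lemma cst_le_exp (C e : R) : 0 < e -> \forall x \near +oo, C <= expR (e * x).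
Proof.
move=> e0; near=> x.
have x1 : 1 <= x by near: x; apply: nbhs_pinfty_ge; exact: num_real.
apply: (@le_trans _ _ (`|C| * x)); last by near: x; exact: linear_le_exp.
by rewrite (le_trans (ler_norm _))// ler_peMr.
Unshelve. all: by end_near. Qed.

Lemma ln_le_linear (C e : R) : 0 < e -> \forall x \near +oo, C * ln x <= e * x.
Proof.
move=> e0; near=> x.
have x0 : 1 < x by near: x; apply: nbhs_pinfty_gt; exact: num_real.
have C1 : 0 < `|C| + 1 by rewrite ltr_wpDl.
have lx : ln x <= e / (`|C| + 1) * x.
  rewrite -ler_expR lnK ?posrE; last by lra.
  rewrite -[leLHS]mul1r; near: x; apply: linear_le_exp.
  by rewrite divr_gt0.
have lx0 : 0 <= ln x by rewrite ln_ge0// ltW.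
apply: (@le_trans _ _ ((`|C| + 1) * ln x)).
  by rewrite ler_wpM2r// (le_trans (ler_norm _))// lerDl.
by rewrite (le_trans (ler_wpM2l (ltW C1) lx))// mulrA mulrCA divff ?mulr1// gt_eqF.
Unshelve. all: by end_near. Qed.

Lemma exprn_le_expR (x y : R) n : 0 <= 1 + x -> n%:R * x <= y ->
  (1 + x) ^+ n <= expR y.
Proof.
move=> x0 xy; apply: (@le_trans _ _ (expR (n%:R * x))); last by rewrite ler_expR.
by rewrite mulrC expRM_natr; apply: lerXn2r; rewrite ?nnegrE ?expR_ge0// expR_ge1Dx.
Qed.

(** Here [G] is the order of the mean [w * G] of a count and of the level [w' * G]
    it has to stay below. The choice [z = w' / w] is the optimal one in Chernoff's
    bound; it makes the exponent [w * (z - 1) - w' * ln z] negative. *)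
Lemma chernoff_rate (c w w' : R) : 0 < c -> 0 < w -> w < w' ->
  exists e z, [/\ 0 < e, 1 <= z & forall (G q p : R) (n0 N kappa : nat),
    0 <= q <= 1 -> 0 <= p <= 1 -> 0 <= G ->
    c * G <= n0%:R * q -> N%:R * p <= w * G -> w' * G <= kappa.+1%:R ->
    (1 - q) ^+ n0 + (1 - p + p * z) ^+ N / z ^+ kappa.+1 <= 2 * expR (- (e * G))].
Proof.
move=> c0 w0 ww'; set z := w' / w.
have z1 : 1 < z by rewrite ltr_pdivlMr// mul1r.
have z0 : 0 < z by lra.
have w'E : w' = w * z by rewrite /z mulrCA divff ?mulr1// gt_eqF.
have lz : z - 1 < z * ln z.
  have := @expR_gt1Dx R (- ln z); rewrite oppr_eq0 ln_eq0// gt_eqF// => /(_ isT).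
  rewrite expRN lnK ?posrE// -(ltr_pM2l z0) divff ?gt_eqF//; lra.
pose e1 := w' * ln z - w * (z - 1).
have e10 : 0 < e1 by rewrite /e1 w'E; nra.
exists (Num.min c e1), z; split; [by rewrite lt_min c0|exact: ltW|].
move=> G q p n0 N kappa q01 p01 G0 hc hp hk.
rewrite mulr_natl mulr2n lerD//.
  apply: exprn_le_expR; first by case/andP: q01; lra.
  rewrite mulrN lerN2; apply: le_trans hc.
  by rewrite ler_wpM2r// ge_min lexx.
rewrite ler_pdivrMr ?exprn_gt0//.
apply: (@le_trans _ _ (expR (w * G * (z - 1)))).
  have -> : 1 - p + p * z = 1 + p * (z - 1) by ring.
  apply: exprn_le_expR; first by case/andP: p01; nra.
  by rewrite mulrA ler_wpM2r// subr_ge0 ltW.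
have -> : z ^+ kappa.+1 = expR (kappa.+1%:R * ln z).
  by rewrite mulrC expRM_natr lnK// posrE.
rewrite -expRD ler_expR.
have lz0 : 0 <= ln z by rewrite ln_ge0// ltW.
have : w' * G * ln z <= kappa.+1%:R * ln z by rewrite ler_wpM2r.
have : Num.min c e1 * G <= e1 * G by rewrite ler_wpM2r// ge_min lexx orbT.
by rewrite /e1; lra.
Qed.

(** For [p = v * G * exp (- G)] and a mean [M] that grows exponentially in [G],
    both terms of the bound in [many_balls] decay exponentially; powers of [G]
    are absorbed by the gap between [theta] and [gamma]. *)
Lemma second_moment_rate (c c' v a theta gamma : R) :
  0 < c -> 0 < c' -> 0 < v -> 0 < a -> gamma < theta ->
  exists2 e, 0 < e & \forall G \near +oo, forall M u : R,
    u = v * G * expR (- G) / a ->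
    c * u `^ (- theta) * (c' * (v * G / a)) * expR (- (gamma * G)) <= M ->
    [/\ 0 < M, 0 <= a * u < 1 &
      (1 + v * G / (1 - a * u)) / M + ((1 - a * u) ^- 2 - 1) <= expR (- (e * G))].
Proof.
move=> c0 c'0 v0 a0 gt; set D := theta - gamma.
have D0 : 0 < D by rewrite subr_gt0.
pose e := Num.min D 1 / 8.
have e0 : 0 < e by rewrite divr_gt0// lt_min D0/=.
have eD : 8 * e <= D by rewrite /e mulrC divfK// ge_min lexx.
have e1 : 8 * e <= 1 by rewrite /e mulrC divfK// ge_min lexx orbT.
have [y yE y0] : exists2 y, y = v / a & 0 < y by exists (v / a); rewrite ?divr_gt0.
exists e => //; near=> G => M u uE hM.
have G0 : 0 < G by near: G; apply: nbhs_pinfty_gt; exact: num_real.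
have au : a * u = v * G * expR (- G) by rewrite uE; field; rewrite gt_eqF.
have hvG : 8 * v * G <= expR (e * G) by near: G; exact: linear_le_exp.
have h4 : 4 <= expR (e * G) by near: G; exact: cst_le_exp.
have uG : 8 * (a * u) <= expR (e * G - G).
  by rewrite au expRD !mulrA ler_wpM2r// expR_ge0.
have E n : expR (n%:R * (e * G)) = expR (e * G) ^+ n by rewrite mulrC expRM_natr.
have uG1 : 8 * (a * u) <= expR (- (7 * (e * G))).
  by apply: (le_trans uG); rewrite ler_expR; nra.
set x := expR (e * G) in hvG h4 E.
have x0 : 0 < x by lra.
have x7 : expR (- (7 * (e * G))) = x ^- 7 by rewrite expRN E.
have x71 : x ^- 7 <= 1.
  by rewrite invf_le1 ?exprn_gt0// exprn_ege1//; lra.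
have u0 : 0 < u by rewrite uE divr_gt0// !mulr_gt0// expR_gt0.
have au0 : 0 < a * u by rewrite mulr_gt0.
have au8 : a * u <= 1 / 8 by lra.
have uyE : u = y * G * expR (- G) by rewrite uE yE; ring.
have lnu : ln u = ln y + ln G - G.
  by rewrite uyE !lnM ?posrE ?mulr_gt0 ?expR_gt0// expRK.
have Mx : x ^+ 4 <= M.
  apply: le_trans hM.
  have -> : u `^ (- theta) = expR (- theta * ln u) by rewrite /powR gt_eqF.
  have -> : c * expR (- theta * ln u) * (c' * (v * G / a)) * expR (- (gamma * G)) =
    expR (ln c + (- theta * ln u) + ln (c' * y) + ln G - gamma * G).
    rewrite 4!expRD lnK ?posrE// lnK ?posrE ?mulr_gt0// lnK ?posrE//.
    by rewrite yE; ring.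
  rewrite -E ler_expR lnu.
  have h1 : (theta - 1) * ln G <= D / 4 * G.
    by near: G; apply: ln_le_linear; rewrite divr_gt0.
  have h2 : theta * ln y - ln c - ln (c' * y) <= D / 4 * G.
    rewrite -ler_pdivrMl; first by near: G; apply: nbhs_pinfty_ge; exact: num_real.
    by rewrite divr_gt0.
  have h3 : 8 * e * G <= D * G by rewrite ler_wpM2r// ltW.
  by move: h1 h2 h3; rewrite /D; lra.
have M0 : 0 < M by apply: lt_le_trans Mx; exact: exprn_gt0.
split=> //; first by rewrite (ltW au0)/=; lra.
move: uG1; rewrite x7 => uG1.
have xV : expR (- (e * G)) = x^-1 by rewrite expRN.
rewrite xV; move: (a * u) au0 au8 uG1 => t t0 t8 tx.
have t1 : 0 < 1 - t by lra.
have i1 : v * G / (1 - t) <= x / 4.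
  rewrite ler_pdivrMr//; have : 0 < v * G by exact: mulr_gt0.
  by nra.
have i2 : (1 + v * G / (1 - t)) / M <= x / 2 / x ^+ 4.
  apply: ler_pM => //.
  - by rewrite addr_ge0// divr_ge0 ?(ltW t1)// mulr_ge0// ltW.
  - by rewrite invr_ge0 ltW.
  - by lra.
  - by rewrite lef_pV2 ?posrE// exprn_gt0.
have i3 : (1 - t) ^- 2 - 1 <= 8 * t.
  rewrite lerBlDr -div1r ler_pdivrMr ?exprn_gt0//.
  rewrite -subr_ge0 [X in 0 <= X](_ : _ = t * (6 - 15 * t + 8 * t ^+ 2)); last by ring.
  by rewrite mulr_ge0 ?(ltW t0)//; nra.
have -> : x^-1 = x / 2 / x ^+ 4 + x^-1 * (1 - x ^- 2 / 2).
  by field; rewrite gt_eqF.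
rewrite lerD// (le_trans i3)// (le_trans tx)//.
have y4 : x^-1 <= 1 / 4 by rewrite div1r lef_pV2 ?posrE.
have yp : 0 < x^-1 by rewrite invr_gt0.
rewrite -!exprVn; move: (x^-1) y4 yp => z z4 z0.
have z2 : z ^+ 2 <= 1 / 16 by nra.
have z6 : z ^+ 6 <= 1 / 2.
  have -> : z ^+ 6 = z ^+ 2 * z ^+ 2 * z ^+ 2 by ring.
  have := sqr_ge0 z; move: (z ^+ 2) z2 => w w1 w0; nra.
rewrite exprS ler_wpM2l//; first exact: ltW.
by lra.
Unshelve. all: by end_near. Qed.

End rates.

Section lower_tail.
Context {R : realType}.

Lemma leq_exp_ffact n m : ((n - m) ^ m <= n ^_ m)%N.
Proof.
elim: m => [|m IH]; first by rewrite expn0 ffactn0.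
rewrite ffactnSr expnSr leq_mul//; last by rewrite leq_sub2l.
by apply: leq_trans IH; case: m => // m; rewrite leq_exp2r// leq_sub2l.
Qed.

(** A crude form of Stirling's formula. *)
Lemma fact_le_expR l : l`!%:R <= l.+1%:R ^+ l.+1 * expR (- l%:R) :> R.
Proof.
elim: l => [|l IH]; first by rewrite fact0 expr1n oppr0 expR0 mulr1.
rewrite factS natrM; apply: (le_trans (ler_wpM2l _ IH)) => //.
have -> : expR (- l.+1%:R) = expR (-1) * expR (- l%:R) :> R.
  by rewrite -expRD -natr1 opprD addrC.
rewrite -[l.+2%:R]natr1.
set n : R := l.+1%:R; have n0 : 0 < n by rewrite ltr0n.
have n1 : 0 < n + 1 by lra.
have key : (1 + - (n + 1)^-1) ^+ l.+2 <= expR (-1).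
  apply: exprn_le_expR; first by rewrite subr_ge0 invf_le1//; lra.
  by rewrite -natr1 -/n mulrN divff// gt_eqF.
have nE : n = (n + 1) * (1 + - (n + 1)^-1) by field; rewrite gt_eqF.
rewrite [leLHS]mulrA -exprS [in leLHS]nE exprMn mulrA ler_wpM2r ?expR_ge0//.
by rewrite ler_wpM2l// exprn_ge0// ltW.
Qed.

Lemma expR_le_oneB (x : R) : 0 <= x < 1 -> expR (- (x / (1 - x))) <= 1 - x.
Proof.
move=> /andP[x0 x1]; have y0 : 0 < 1 - x by rewrite subr_gt0.
rewrite expRN -[leRHS]invrK lef_pV2 ?posrE ?expR_gt0 ?invr_gt0//.
apply: le_trans (expR_ge1Dx _).
by rewrite [leRHS](_ : _ = (1 - x)^-1)//; field; rewrite gt_eqF.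
Qed.

Lemma bin_exp_ge (N l : nat) (p w : R) : 0 <= p -> 0 <= w -> (l <= N)%N ->
  w <= (N%:R - l%:R) * p ->
  (w * expR 1 / l.+1%:R) ^+ l / l.+1%:R <= 'C(N, l)%:R * p ^+ l.
Proof.
move=> p0 w0 lN hw.
have f0 : 0 < l`!%:R :> R by rewrite ltr0n fact_gt0.
have h : (N%:R - l%:R) ^+ l <= 'C(N, l)%:R * l`!%:R :> R.
  by rewrite -natrB// -natrX -natrM bin_ffact ler_nat leq_exp_ffact.
have s0 : 0 < l.+1%:R :> R by rewrite ltr0n.
apply: (@le_trans _ _ (w ^+ l / l`!%:R)).
  rewrite ler_pdivlMr//.
  have e1 : expR 1 ^+ l = expR l%:R :> R by rewrite -expRM_natr mul1r.
  apply: (le_trans (ler_wpM2l _ (fact_le_expR l))).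
    by rewrite divr_ge0 ?exprn_ge0 ?divr_ge0 ?mulr_ge0 ?expR_ge0.
  rewrite !exprMn e1 exprVn expRN exprS.
  by rewrite le_eqVlt; apply/orP; left; apply/eqP; field; rewrite !gt_eqF ?exprn_gt0 ?expR_gt0.
rewrite ler_pdivrMr//; apply: (@le_trans _ _ (((N%:R - l%:R) * p) ^+ l)).
  by apply: lerXn2r; rewrite ?nnegrE// (le_trans w0).
by rewrite exprMn mulrAC ler_wpM2r ?exprn_ge0.
Qed.

(** The single term of the binomial law at the integer part of [b * G] already has
    the right exponential order, by Stirling's formula; [eta] allows for the
    difference between [N] and [n0]. *)
Lemma binom_lt_rate (b v gamma : R) : 0 <= b -> b <= v -> 0 < v ->
  v * H (b / v) < gamma ->
  exists2 eta : R, 0 < eta & \forall G \near +oo, forall n0 N : nat,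
    n0%:R = expR G :> R -> (n0 <= N)%N -> N%:R <= (1 + eta) * n0%:R ->
    expR (- (gamma * G)) <= binom_lt N (Num.truncn (b * G)).+1 (v * G / n0%:R).
Proof.
move=> b0 bv v0 hg; set D := gamma - v * H (b / v).
have D0 : 0 < D by rewrite subr_gt0.
have S0 : 0 < 2 * (3 * v + 4 * b + 1) by rewrite mulr_gt0//; lra.
pose eta := Num.min (1 / 4) (D / (2 * (3 * v + 4 * b + 1))).
have e0 : 0 < eta by rewrite lt_min !divr_gt0.
have e4 : eta <= 1 / 4 by rewrite ge_min lexx.
have eD : eta * (2 * (3 * v + 4 * b + 1)) <= D by rewrite -ler_pdivlMr// ge_min lexx orbT.
exists eta => //; near=> G => n0 N nG n0N hN.
have G0 : 0 < G by near: G; exact: nbhs_pinfty_gt.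
have n00 : 0 < n0%:R :> R by rewrite nG expR_gt0.
set p := v * G / n0%:R; set l := Num.truncn (b * G).
have p0 : 0 <= p by rewrite divr_ge0 ?mulr_ge0// ltW.
have pe : p <= eta / 2.
  rewrite ler_pdivrMr// -ler_pdivrMl ?divr_gt0// mulrA nG -[G in expR G]mul1r.
  by near: G; exact: linear_le_exp.
have p1 : p < 1 by lra.
have bG0 : 0 <= b * G by rewrite mulr_ge0// ltW.
have /andP[lb bl] := truncn_itv bG0; rewrite -/l in lb bl.
have ln0 : l%:R <= eta * n0%:R.
  rewrite (le_trans lb)// -ler_pdivrMl// mulrA nG -[G in expR G]mul1r.
  by near: G; exact: linear_le_exp.
have lN : (l <= N)%N.
  by rewrite -(ler_nat R) (le_trans ln0)//; move: n0N; rewrite -(ler_nat R); nra.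
apply: le_trans (binom_lt_ge_bin N l _); last by rewrite p0 ltW.
have tail : expR (- ((1 + 3 * eta) * (v * G))) <= (1 - p) ^+ N.
  have := expR_le_oneB (_ : 0 <= p < 1); rewrite p0 p1 => /(_ isT) h.
  apply: (@le_trans _ _ (expR (- (p / (1 - p))) ^+ N)); last first.
    by apply: lerXn2r => //; rewrite nnegrE ?expR_ge0// subr_ge0 ltW.
  rewrite -expRM_natr ler_expR mulNr lerN2.
  have np : n0%:R * p = v * G by rewrite /p mulrC divfK// gt_eqF.
  have Np : N%:R * p <= (1 + eta) * (v * G).
    by rewrite -np [leRHS]mulrA ler_wpM2r.
  rewrite mulrAC ler_pdivrMr; last by lra.
  have he : 1 + eta <= (1 + 3 * eta) * (1 - p) by nra.
  rewrite [p * _]mulrC (le_trans Np)// mulrAC ler_wpM2r// mulr_ge0//; exact: ltW.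
have [b00|bp] := eqVneq b 0.
  have -> : l = 0%N by rewrite /l b00 mul0r truncn0.
  rewrite bin0 expr0 !mul1r; apply: le_trans tail; rewrite ler_expR lerN2.
  have := eD; rewrite /D /H b00 mul0r eqxx mulr1 => eD'.
  by have : 0 < v * G by [exact: mulr_gt0]; nra.
have {}bp : 0 < b by rewrite lt_neqAle eq_sym bp.
pose w := (1 - eta) * (v * G).
have w0 : 0 <= w by rewrite mulr_ge0 ?mulr_ge0 ?(ltW v0) ?(ltW G0)//; lra.
have hw : w <= (N%:R - l%:R) * p.
  have np : n0%:R * p = v * G by rewrite /p mulrC divfK// gt_eqF.
  rewrite /w -np [leLHS]mulrA ler_wpM2r// mulrBl mul1r lerB// ler_nat//.
have := bin_exp_ge p0 w0 lN hw => hbin.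
pose tau := 1 - 4 * eta + ln (v / b).
have vb1 : 1 <= v / b by rewrite ler_pdivlMr// mul1r.
have tau0 : 0 <= tau.
  by rewrite addr_ge0 ?ln_ge0//; lra.
have bGe : b * G + 1 <= expR (eta * G).
  have h1 : 2 * b * G <= expR (eta * G) by near: G; exact: linear_le_exp.
  have h2 : 2 <= expR (eta * G) by near: G; exact: cst_le_exp.
  by lra.
have ebG : 1 <= eta * b * G.
  by rewrite -ler_pdivrMl ?mulr_gt0// mulr1; near: G; apply: nbhs_pinfty_ge; exact: num_real.
have lp : 0 < l.+1%:R :> R by rewrite ltr0n.
have l1 : l.+1%:R <= b * G + 1 by rewrite -natr1 lerD2r.
have ratio : expR tau <= w * expR 1 / l.+1%:R.
  have me : expR (- (2 * eta)) <= 1 - eta.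
    apply: le_trans (expR_le_oneB _); last by rewrite (ltW e0)/=; lra.
    rewrite ler_expR lerN2 ler_pdivrMr; last by lra.
    by nra.
  have mee : expR (- (4 * eta)) <= (1 - eta) ^+ 2.
    have -> : - (4 * eta) = - (2 * eta) + - (2 * eta) by ring.
    by rewrite expRD -expr2 ler_sqr ?nnegrE ?expR_ge0//; lra.
  have -> : expR tau = expR 1 * (expR (- (4 * eta)) * (v / b)).
    by rewrite /tau !expRD lnK ?posrE ?divr_gt0// [RHS]mulrA.
  have -> : w * expR 1 / l.+1%:R = expR 1 * (w / l.+1%:R) by ring.
  rewrite ler_wpM2l ?expR_ge0// ler_pdivlMr//.
  apply: (@le_trans _ _ ((1 - eta) ^+ 2 * (v / b) * (b * G + 1))).
    have vb0 : 0 <= v / b by exact: le_trans vb1.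
    by apply: ler_pM => //; [rewrite mulr_ge0// expR_ge0|rewrite ler_wpM2r].
  have -> : (1 - eta) ^+ 2 * (v / b) * (b * G + 1) =
      (1 - eta) * v / b * ((1 - eta) * (b * G + 1)) by ring.
  have -> : w = (1 - eta) * v / b * (b * G) by rewrite /w; field; rewrite gt_eqF.
  rewrite ler_wpM2l//; last by lra.
  by rewrite divr_ge0 ?(ltW bp)// mulr_ge0 ?(ltW v0)//; lra.
apply: (@le_trans _ _ (expR (tau * (b * G - 1)) * expR (- (eta * G)) *
    expR (- ((1 + 3 * eta) * (v * G))))).
  rewrite -!expRD ler_expR.
  have hG : 2 * tau <= D * G.
    by rewrite -ler_pdivrMl//; near: G; apply: nbhs_pinfty_ge; exact: num_real.
  have lnE : v * H (b / v) = v - b - b * ln (v / b).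
    rewrite /H gt_eqF ?divr_gt0//.
    have -> : b / v = (v / b)^-1 by rewrite invf_div.
    rewrite lnV ?posrE ?divr_gt0//.
    by field; rewrite !gt_eqF.
  have gE : gamma = D + (v - b - b * ln (v / b)) by rewrite -lnE /D; ring.
  have h3 : eta * (2 * (3 * v + 4 * b + 1)) * G <= D * G by rewrite ler_wpM2r// ltW.
  rewrite gE; move: h3 hG; rewrite /tau; lra.
apply: ler_pM => //; rewrite ?mulr_ge0 ?expR_ge0//.
apply: le_trans hbin; apply: ler_pM; rewrite ?expR_ge0//.
  apply: (@le_trans _ _ (expR tau ^+ l)).
    rewrite -expRM_natr ler_expR ler_wpM2l//.
    by move: bl; rewrite -natr1; lra.
  by apply: lerXn2r => //; rewrite nnegrE ?expR_ge0// (le_trans (expR_ge0 _) ratio).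
by rewrite expRN lef_pV2 ?posrE ?expR_gt0// (le_trans l1).
Unshelve. all: by end_near. Qed.

End lower_tail.

(** * Blocks of sample sizes *)

Section blocks.
Context {R : realType}.

(** Exceptional probabilities that are only a small negative power of the sample
    size become summable along the sizes [(j + 1) ^ K] for large [K], while
    consecutive such sizes have ratio tending to [1]. *)
Definition bsize (K j : nat) : nat := (j.+1 ^ K)%N.

Definition blog (K j : nat) : R := ln (bsize K j)%:R.

Lemma bsize_gt0 K j : (0 < bsize K j)%N.
Proof. by rewrite expn_gt0. Qed.

Lemma expR_blog K j : expR (blog K j) = (bsize K j)%:R.
Proof. by rewrite lnK// posrE ltr0n bsize_gt0. Qed.

Lemma blogE K j : blog K j = K%:R * ln j.+1%:R.
Proof.
rewrite /blog /bsize natrX lnXn ?ltr0n//.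
by rewrite mulr_natl.
Qed.

Lemma blog_pinfty (K : nat) (Q : R -> Prop) : (0 < K)%N ->
  (\forall x \near +oo, Q x) -> \forall j \near \oo, Q (blog K j).
Proof.
move=> K0 [M [_ hM]]; have [J _ hJ] := @nbhs_infty_ger R (expR M + 1).
exists J => // j /hJ /= hj; apply: hM; rewrite -ltr_expR expR_blog.
apply: (@lt_le_trans _ _ j%:R); first by rewrite (lt_le_trans _ hj)// ltrDl.
rewrite ler_nat; apply: leq_trans (leqnSn j) _.
by rewrite /bsize -[leqLHS]expn1 leq_pexp2l.
Qed.

Lemma bsize_cover K J : (0 < K)%N ->
  \forall n \near \oo, exists2 j, (J <= j)%N & (bsize K j <= n <= bsize K j.+1)%N.
Proof.
move=> K0; exists (bsize K J) => // n /= Jn.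
have ub j : (bsize K j <= n)%N -> (j <= n)%N.
  apply: leq_trans; apply: leq_trans (leqnSn j) _.
  by rewrite /bsize -[leqLHS]expn1 leq_pexp2l.
have ex : exists j, (bsize K j <= n)%N by exists J.
case: (ex_maxnP ex ub) => j jn jmax; exists j; first exact: jmax.
rewrite jn /= leqNgt; apply/negP => /ltnW /jmax; by rewrite ltnn.
Qed.

Lemma bsize_ratio K (eta : R) : 0 < eta ->
  \forall j \near \oo, (bsize K j.+1)%:R <= (1 + eta) * (bsize K j)%:R :> R.
Proof.
move=> e0; have l0 : 0 < ln (1 + eta) by rewrite ln_gt0// ltrDl.
have [J _ hJ] := @nbhs_infty_ger R (K%:R / ln (1 + eta)).
exists J => // j /hJ /= hj.
have j0 : 0 < j.+1%:R :> R by rewrite ltr0n.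
rewrite /bsize !natrX -ler_pdivrMr ?exprn_gt0// -expr_div_n.
have -> : j.+2%:R / j.+1%:R = 1 + j.+1%:R^-1 :> R.
  by rewrite -[j.+2%:R]natr1 mulrDl divff ?gt_eqF// div1r.
rewrite -[leRHS]lnK; last by rewrite posrE ltr_wpDr// ltW.
apply: exprn_le_expR; first by rewrite addr_ge0// invr_ge0.
rewrite ler_pdivrMr// -ler_pdivrMl// mulrC (le_trans hj)// ler_nat//.
Qed.

Lemma blog_next K : \forall j \near \oo, ln (bsize K j.+1)%:R <= blog K j + 1 :> R.
Proof.
near=> j; rewrite -ler_expR lnK ?posrE ?ltr0n ?bsize_gt0// expRD expR_blog mulrC.
apply: (@le_trans _ _ ((1 + 1) * (bsize K j)%:R)); last first.
  by rewrite ler_wpM2r// expR_ge1Dx.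
by near: j; exact: bsize_ratio.
Unshelve. all: by end_near. Qed.

Lemma expR_le_inv_square (y : R) (j : nat) : (0 < j)%N -> 3 * ln j.+1%:R <= y ->
  2 * expR (- y) <= j.+1%:R ^- 2.
Proof.
move=> j0 hy; have j1 : 0 < j.+1%:R :> R by rewrite ltr0n.
have -> : j.+1%:R ^- 2 = j.+1%:R * expR (- (3 * ln j.+1%:R)) :> R.
  by rewrite mulrC expRN expRM_natl lnK ?posrE//; field; rewrite gt_eqF.
by apply: ler_pM; rewrite ?expR_ge0// ?ler_nat// ler_expR lerN2.
Qed.

End blocks.

(** * Balls of small measure with cores of comparable measure *)

Section packing.
Context {R : realType} {A : pointedMetricType R}
  (mu : probability (borelType A) R) (d eps' a b : R)
  (hd : 0 < d) (heps' : 0 < eps') (ha : 0 < a)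
  (hmu : forall (r : R) (x : A), 0 < r < 1 ->
      ((eps' * r `^ d)%:E <= mu (cball x r))%E)
  (hnu : bigOmega_at0 (fun r : R => packing_number mu r (a * r `^ d))
                      (fun r : R => r `^ (- b))).

(** Balls are indexed by the [d]-th power [u] of their radius, to which measures
    are compared. A point of the core of radius [u `^ d^-1 - (rho * u) `^ d^-1]
    has its ball of radius [(rho * u) `^ d^-1] inside the whole ball. *)
Lemma packing_cores (rho : R) : 0 < rho < 1 ->
  exists c c0 : R, [/\ 0 < c, 0 < c0 &
    \forall u \near 0^'+, exists (m : nat) (x : 'I_m -> A),
    [/\ c * u `^ (- (b / d)) <= m%:R,
        trivIset setT (fun i => cball (x i) (u `^ d^-1)),
        forall i, (mu (cball (x i) (u `^ d^-1)) <= (a * u)%:E)%E &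
        forall i, ((c0 * u)%:E <=
          mu (cball (x i) (u `^ d^-1 - (rho * u) `^ d^-1)))%E]].
Proof.
move=> /andP[rho0 rho1]; have [c c0 [e /= e0 he]] := packing_near0 hnu.
pose s := rho `^ d^-1; have d0 : 0 < d^-1 by rewrite invr_gt0.
have s1 : s < 1.
  have := gt0_ltr_powR d0 (_ : rho \in Num.nneg) (_ : 1 \in Num.nneg) rho1.
  by rewrite powR1; apply; rewrite nnegrE// ltW.
have s0 : 0 < 1 - s by rewrite subr_gt0.
have sge0 : 0 <= s by exact: powR_ge0.
exists c, (eps' * (1 - s) `^ d); split => //; first by rewrite mulr_gt0// powR_gt0.
have ed : 0 < Num.min 1 (e `^ d) by rewrite lt_min ltr01 powR_gt0.
exists (Num.min 1 (e `^ d)) => //= u /= + u0.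
rewrite /ball/= sub0r normrN gtr0_norm// lt_min => /andP[u1 ue].
have r0 : 0 < u `^ d^-1 by rewrite powR_gt0.
have root t : 0 <= t -> (t `^ d) `^ d^-1 = t.
  by move=> t0; rewrite -powRrM divff ?gt_eqF// powRr1.
have rd : (u `^ d^-1) `^ d = u by rewrite -powRrM mulVf ?gt_eqF// powRr1// ltW.
have re : u `^ d^-1 < e.
  rewrite -(root e (ltW e0)); apply: gt0_ltr_powR => //; rewrite nnegrE ?powR_ge0//.
  exact: ltW.
have r1 : u `^ d^-1 < 1.
  have := gt0_ltr_powR d0 (_ : u \in Num.nneg) (_ : 1 \in Num.nneg) u1.
  by rewrite powR1; apply; rewrite nnegrE// ltW.
have [|m [x [cm trx mx]]] := he (u `^ d^-1) _ r0.
  by rewrite /ball/= sub0r normrN gtr0_norm.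
exists m, x; split => //.
- by move: cm; rewrite -powRrM mulrN (mulrC d^-1).
- by move=> i; rewrite -[X in (a * X)%:E]rd.
move=> i; have cE : u `^ d^-1 - (rho * u) `^ d^-1 = (1 - s) * u `^ d^-1.
  by rewrite powRM ?(ltW rho0) ?(ltW u0)// mulrBl mul1r.
rewrite cE; apply: le_trans (hmu _ _); last first.
  rewrite mulr_gt0//=; apply: le_lt_trans r1; rewrite ler_piMl//; first exact: ltW.
  by rewrite lerBlDr lerDl.
by rewrite lee_fin powRM ?(ltW s0) ?(ltW r0)// rd mulrA.
Qed.

Context {disp : measure_display} {Omega : measurableType disp}
  {P : probability Omega R} {X : nat -> {RV P >-> borelType A}}
  (Xindep : mutually_independent X)
  (Xlaw : forall (i : nat) (B : set (borelType A)), measurable B ->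
      distribution P (X i) B = mu B).

Lemma npointsE N (C : set A) w :
  npoints (fun i => X i w : A) N C = hits X (iota 0 N) C w.
Proof.
rewrite /npoints; elim: N => [|N IH]; first by rewrite big_ord0.
have -> : iota 0 N.+1 = iota 0 N ++ [:: N] by rewrite -addn1 iotaD.
by rewrite big_ord_recr /= IH /hits count_cat/= addn0.
Qed.

(** The event that forces the threshold up to [(rho * u) `^ d^-1], by [Lnk_ge]. *)
Definition core_hit (rho u : R) (n0 N kappa : nat) (w : Omega) : Prop :=
  exists c : A, exists2 t, (t < n0)%N &
    cball c (u `^ d^-1 - (rho * u) `^ d^-1) (X t w) /\
    (hits X (iota 0 N) (cball c (u `^ d^-1)) w <= kappa)%N.

(** One event controls a whole range of sample sizes, so that the Borel-Cantelli
    lemma can be applied along a sparse sequence of stages [j]. *)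
Lemma ae_threshold_ge (k : nat -> nat) (g : nat -> R) (n0 N kappa : nat -> nat)
    (u : nat -> R) (rho l : R) : 0 < rho ->
  (\forall j \near \oo, 0 <= u j /\ exists Bad, [/\ measurable Bad,
     (P Bad <= (j.+1%:R ^- 2)%:E)%E &
     forall w, ~ Bad w -> core_hit rho (u j) (n0 j) (N j) (kappa j) w]) ->
  (forall J, \forall n \near \oo, exists2 j, (J <= j)%N &
     [/\ (n0 j <= n <= N j)%N, (kappa j <= k n)%N, 0 <= g n &
         l <= n%:R * (rho * u j) * (g n)^-1]) ->
  {ae P, forall w, \forall n \near \oo,
    (l%:E <= n%:R%:E * poweR (Lnk (fun i => X i w : A) n (k n)) d * ((g n)^-1)%:E)%E}.
Proof.
move=> rho0 hbad hn.
have : {ae P, forall w, \forall j \near \oo, 0 <= u j /\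
      core_hit rho (u j) (n0 j) (N j) (kappa j) w}.
  apply: borel_cantelli_near; apply: filterS hbad => j [uj [Bad [h1 h2 h3]]].
  by exists Bad; split => // w /h3.
apply: filterS => w [J _ hJ]; apply: filterS (hn J) => n [j /hJ/=].
move=> [uj [c [t tn0 [ct hc]]]] [hjn kk gn ln].
have ru : 0 <= rho * u j by rewrite mulr_ge0// ltW.
have Lge : (((rho * u j) `^ d^-1)%:E <= Lnk (fun i => X i w : A) n (k n))%E.
  apply: (@Lnk_ge _ _ _ (n0 j) (N j) n (k n) t c (u j `^ d^-1)) => //.
  by rewrite npointsE (leq_trans hc).
apply: (@le_trans _ _ (n%:R%:E * (rho * u j)%:E * ((g n)^-1)%:E)%E).
  by rewrite -!EFinM lee_fin.
apply: lee_wpmul2r; first by rewrite lee_fin invr_ge0.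
apply: lee_wpmul2l; first by rewrite lee_fin.
have -> : ((rho * u j)%:E = poweR ((rho * u j) `^ d^-1)%:E d)%E.
  by rewrite poweR_EFin -powRrM mulVf ?gt_eqF// powRr1.
apply: gt0_ler_poweR => //; first exact: ltW.
- by rewrite in_itv/= lee_fin powR_ge0 leey.
- by rewrite in_itv/= leey andbT (le_trans _ Lge)// lee_fin powR_ge0.
Qed.

(** One factor [rho] is the ratio of the [d]-th powers of the two radii; the other
    one absorbs the variation of [ln n] within a block. *)
Lemma ae_log_threshold_ge (k : nat -> nat) (K : nat) (kap : R -> nat) (v rho : R) :
  0 < rho < 1 -> 0 < v -> (0 < K)%N ->
  {homo kap : x y / x <= y >-> (x <= y)%N} ->
  (\forall n \near \oo, (kap (ln n%:R) <= k n)%N) ->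
  (\forall j \near \oo, exists Bad, [/\ measurable Bad,
     (P Bad <= (j.+1%:R ^- 2)%:E)%E & forall w, ~ Bad w ->
       core_hit rho (v * blog K j * expR (- blog K j) / a)
         (bsize K j) (bsize K j.+1) (kap (blog K j)) w]) ->
  {ae P, forall w, \forall n \near \oo,
    ((rho ^+ 2 * v / a)%:E <=
      n%:R%:E * poweR (Lnk (fun i => X i w : A) n (k n)) d * ((ln n%:R)^-1)%:E)%E}.
Proof.
move=> /andP[rho0 rho1] v0 K0 kmono hk hbad.
have bl0 : \forall j \near \oo, 0 < blog K j :> R.
  by apply: (@blog_pinfty _ K (fun x => 0 < x)) => //; apply: nbhs_pinfty_gt; exact: num_real.
apply: (@ae_threshold_ge k _ (bsize K) (fun j => bsize K j.+1) (fun j => kap (blog K j))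
  (fun j => v * blog K j * expR (- blog K j) / a) rho) => //.
  apply: filterS2 hbad bl0 => j hb bj; split; last exact: hb.
  by rewrite divr_ge0 ?(ltW ha)// mulr_ge0 ?expR_ge0// mulr_ge0 ?(ltW v0)// ltW.
move=> J.
have hl : \forall j \near \oo, rho * (blog K j + 1) <= blog K j :> R.
  apply: (@blog_pinfty _ K (fun x => rho * (x + 1) <= x)) => //; near=> x.
  have : rho / (1 - rho) <= x by near: x; apply: nbhs_pinfty_ge; exact: num_real.
  by rewrite ler_pdivrMr ?subr_gt0//; lra.
have hnx := blog_next (R := R) K.
have [J1 _ hJ1] : \forall j \near \oo, [/\ 0 < blog K j :> R, rho * (blog K j + 1) <= blog K j :> R &
    ln (bsize K j.+1)%:R <= blog K j + 1 :> R].
  by near=> j; split; near: j.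
near=> n.
have [j] : exists2 j, (maxn J J1 <= j)%N & (bsize K j <= n <= bsize K j.+1)%N.
  by near: n; exact: bsize_cover.
rewrite geq_max => /andP[Jj /hJ1 [bj rbj lbj]] hn; exists j => //.
have /andP[jn nj] := hn.
have n0 : 0 < n%:R :> R by rewrite ltr0n (leq_trans (bsize_gt0 K j)).
have bn0 : 0 < (bsize K j)%:R :> R by rewrite ltr0n bsize_gt0.
have lnn : blog K j <= ln n%:R :> R by rewrite /blog ler_ln ?posrE// ler_nat.
have lnN : ln n%:R <= blog K j + 1 :> R.
  by apply: le_trans lbj; rewrite ler_ln ?posrE// ?ler_nat// ltr0n bsize_gt0.
have ln0 : 0 < ln n%:R :> R by exact: lt_le_trans lnn.
split=> //; first by apply: leq_trans (kmono _ _ lnn) _; near: n.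
  exact: ltW.
rewrite expRN expR_blog ler_pdivlMr//.
have -> : n%:R * (rho * (v * blog K j / (bsize K j)%:R / a)) =
  rho * v / a * (blog K j * (n%:R / (bsize K j)%:R)).
  by field; rewrite !gt_eqF.
have -> : rho ^+ 2 * v / a * ln n%:R = rho * v / a * (rho * ln n%:R) by ring.
have rva : 0 <= rho * v / a by rewrite divr_ge0 ?(ltW ha)// mulr_ge0 ?ltW.
rewrite ler_wpM2l//; apply: (@le_trans _ _ (blog K j)).
  by apply: le_trans rbj; rewrite ler_wpM2l// ltW.
by rewrite ler_peMr ?(ltW bj)// ler_pdivlMr// mul1r ler_nat.
Unshelve. all: by end_near. Qed.

(** * The exceptional events *)

Let near0_exp (v : R) (Q : R -> Prop) : 0 < v -> (\forall u \near 0^'+, Q u) ->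
  \forall G \near +oo, Q (v * G * expR (- G) / a).
Proof.
move=> v0 [e /= e0 he]; near=> G.
have G0 : 0 < G by near: G; apply: nbhs_pinfty_gt; exact: num_real.
have u0 : 0 < v * G * expR (- G) / a by rewrite divr_gt0// !mulr_gt0// expR_gt0.
apply: he => //; rewrite /ball/= sub0r normrN gtr0_norm//.
rewrite ltr_pdivrMr// expRN ltr_pdivrMr ?expR_gt0//.
have ea : 0 < e * a / 2 by rewrite divr_gt0// mulr_gt0.
apply: (@le_lt_trans _ _ (e * a / 2 * expR G)).
  rewrite -ler_pdivrMl// mulrA -[G in expR G]mul1r.
  by near: G; exact: linear_le_exp.
by rewrite ltr_pM2r ?expR_gt0// gtr_pMr ?mulr_gt0// invf_lt1// ltr1n.
Unshelve. all: by end_near. Qed.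

Let mu_fine (B : set (borelType A)) : measurable B -> mu B = (fine (mu B))%:E.
Proof. by move=> mB; rewrite fineK// fin_num_measure. Qed.

Let mu_fine01 (B : set (borelType A)) : measurable B -> 0 <= fine (mu B) <= 1.
Proof.
by move=> mB; rewrite fine_ge0//= -lee_fin -mu_fine//; exact: probability_le1.
Qed.

Lemma one_ball_rate (rho c1 v v' : R) : 0 < rho < 1 -> 0 < c1 -> 0 < v -> v < v' ->
  exists2 e, 0 < e & \forall u \near 0^'+, forall (G : R) (n0 N kappa : nat),
    0 <= G -> c1 * G <= n0%:R * u -> N%:R * (a * u) <= v * G ->
    v' * G <= kappa.+1%:R ->
    exists Bad, [/\ measurable Bad, (P Bad <= (2 * expR (- (e * G)))%:E)%E &
      forall w, ~ Bad w -> core_hit rho u n0 N kappa w].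
Proof.
move=> rho01 c10 v0 vv'; have [c [c0 [cp c0p hc]]] := packing_cores rho01.
have [e [z [e0 z1 hz]]] := chernoff_rate (mulr_gt0 c10 c0p) v0 vv'.
exists e => //; near=> u => G n0 N kappa G0 h1 h2 h3.
have u0 : 0 < u by near: u; exact: nbhs_right_gt.
have [m [x [cm _ xC xB]]] : exists (m : nat) (x : 'I_m -> A),
    [/\ c * u `^ (- (b / d)) <= m%:R,
        trivIset setT (fun i => cball (x i) (u `^ d^-1)),
        forall i, (mu (cball (x i) (u `^ d^-1)) <= (a * u)%:E)%E &
        forall i, ((c0 * u)%:E <=
          mu (cball (x i) (u `^ d^-1 - (rho * u) `^ d^-1)))%E].
  by near: u; exact: hc.
have m0 : (0 < m)%N.
  by rewrite -(ltr_nat R); apply: lt_le_trans cm; rewrite mulr_gt0// powR_gt0.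
pose i := Ordinal m0; set B := cball (x i) (u `^ d^-1 - (rho * u) `^ d^-1).
set C := cball (x i) (u `^ d^-1).
have mB : measurable (B : set (borelType A)) by exact: measurable_cball.
have mC : measurable (C : set (borelType A)) by exact: measurable_cball.
have [Bad [mBad PBad hBad]] := one_ball Xindep Xlaw n0 N kappa mB mC z1.
exists Bad; split => //; last first.
  by move=> w /hBad[t tn0 [Bt hC]]; exists (x i), t.
apply: (le_trans PBad); rewrite lee_fin; apply: hz => //.
- exact: mu_fine01.
- exact: mu_fine01.
- apply: (@le_trans _ _ (n0%:R * (c0 * u))).
    by rewrite mulrAC mulrCA [leRHS]mulrC ler_wpM2r// ltW.
  by rewrite ler_wpM2l// -lee_fin -mu_fine//; exact: xB.
- apply: le_trans h2; rewrite ler_wpM2l// -lee_fin -mu_fine//; exact: xC.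
Unshelve. all: by end_near. Qed.

(** The number of balls is [expR (b / d * G)], up to powers of [G], and each of them
    is hit with probability at least [expR (- (gamma * G))] for some
    [gamma < b / d], again up to powers of [G]: the mean number of hits is
    exponentially large in [G]. *)
Lemma many_balls_rate (rho v v' : R) : 0 < rho < 1 -> 0 <= v' -> v' <= v -> 0 < v ->
  v * H (v' / v) < b / d ->
  exists e eta : R, [/\ 0 < e, 0 < eta & \forall G \near +oo, forall n0 N : nat,
    n0%:R = expR G :> R -> (n0 <= N)%N -> N%:R <= (1 + eta) * n0%:R ->
    exists Bad, [/\ measurable Bad, (P Bad <= (expR (- (e * G)))%:E)%E &
      forall w, ~ Bad w -> core_hit rho (v * G * expR (- G) / a) n0 N
        (Num.truncn (v' * G)).+1 w]].
Proof.
move=> rho01 v'0 v'v v0 hH; have [c [c0 [cp c0p hc]]] := packing_cores rho01.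
pose gamma := (v * H (v' / v) + b / d) / 2.
have g1 : v * H (v' / v) < gamma by rewrite /gamma; lra.
have g2 : gamma < b / d by rewrite /gamma; lra.
have [eta eta0 htail] := binom_lt_rate v'0 v'v v0 g1.
have [e e0 hM] := second_moment_rate cp c0p v0 ha g2.
exists e, eta; split => //; near=> G => n0 N n0G n0N hN.
have htailG : forall n0 N : nat, n0%:R = expR G :> R -> (n0 <= N)%N ->
    N%:R <= (1 + eta) * n0%:R ->
    expR (- (gamma * G)) <= binom_lt N (Num.truncn (v' * G)).+1 (v * G / n0%:R).
  by near: G; exact: htail.
have hMG : forall M u : R, u = v * G * expR (- G) / a ->
    c * u `^ (- (b / d)) * (c0 * (v * G / a)) * expR (- (gamma * G)) <= M ->
    [/\ 0 < M, 0 <= a * u < 1 &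
      (1 + v * G / (1 - a * u)) / M + ((1 - a * u) ^- 2 - 1) <= expR (- (e * G))].
  by near: G; exact: hM.
have G0 : 0 < G by near: G; apply: nbhs_pinfty_gt; exact: num_real.
set u := v * G * expR (- G) / a.
have [m [x [cm trx xC xB]]] : exists (m : nat) (x : 'I_m -> A),
    [/\ c * u `^ (- (b / d)) <= m%:R,
        trivIset setT (fun i => cball (x i) (u `^ d^-1)),
        forall i, (mu (cball (x i) (u `^ d^-1)) <= (a * u)%:E)%E &
        forall i, ((c0 * u)%:E <=
          mu (cball (x i) (u `^ d^-1 - (rho * u) `^ d^-1)))%E].
  by rewrite /u; near: G; exact: (near0_exp v0 hc).
set kappa := (Num.truncn (v' * G)).+1.
pose B i := cball (x i) (u `^ d^-1 - (rho * u) `^ d^-1).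
pose C i := cball (x i) (u `^ d^-1).
have mB i : measurable (B i : set (borelType A)) by exact: measurable_cball.
have mC i : measurable (C i : set (borelType A)) by exact: measurable_cball.
have BC i : B i `<=` C i.
  by move=> y /le_trans; apply; rewrite lerBlDr lerDl powR_ge0.
have n00 : 0 < n0%:R :> R by rewrite n0G expR_gt0.
have au : a * u = v * G / n0%:R by rewrite /u n0G expRN; field; rewrite !gt_eqF ?expR_gt0.
have au1 : a * u <= 1.
  rewrite au n0G ler_pdivrMr ?expR_gt0// mul1r -[X in expR X]mul1r.
  by near: G; exact: linear_le_exp.
have Cu i : fine (mu (C i)) <= a * u by rewrite -lee_fin -mu_fine//; exact: xC.
have Bu i : c0 * u <= fine (mu (B i)) by rewrite -lee_fin -mu_fine//; exact: xB.
have u0 : 0 < u by rewrite divr_gt0// !mulr_gt0// expR_gt0.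
pose M := \sum_i n0%:R * (fine (mu (B i)) * binom_lt N.-1 kappa (fine (mu (C i)))).
have Htail : expR (- (gamma * G)) <= binom_lt N kappa (a * u).
  by rewrite au /kappa; exact: htailG.
have [M0 au01 hMe] : [/\ 0 < M, 0 <= a * u < 1 &
   (1 + v * G / (1 - a * u)) / M + ((1 - a * u) ^- 2 - 1) <= expR (- (e * G))].
  have : c * u `^ (- (b / d)) * (c0 * (v * G / a)) * expR (- (gamma * G)) <= M ->
   [/\ 0 < M, 0 <= a * u < 1 &
   (1 + v * G / (1 - a * u)) / M + ((1 - a * u) ^- 2 - 1) <= expR (- (e * G))].
    exact: hMG.
  apply; apply: (@le_trans _ _ (m%:R * (n0%:R * (c0 * u * expR (- (gamma * G)))))).
    have -> : v * G / a = n0%:R * u.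
      by rewrite -[v * G / a]mul1r; rewrite /u n0G expRN; field; rewrite !gt_eqF ?expR_gt0.
    rewrite [leRHS](_ : _ = m%:R * (c0 * (n0%:R * u)) * expR (- (gamma * G))); last by ring.
    by rewrite ler_wpM2r ?expR_ge0// ler_wpM2r// mulr_ge0 ?(ltW c0p)// mulr_ge0// ltW.
  rewrite /M mulr_natl -[m in _ *+ m]card_ord -sumr_const; apply: ler_sum => i _.
  rewrite ler_wpM2l//; apply: ler_pM; rewrite ?expR_ge0//.
    by rewrite mulr_ge0 ?(ltW c0p)// ltW.
  apply: (le_trans Htail); apply: (@le_trans _ _ (binom_lt N kappa (fine (mu (C i))))).
    by apply: binom_lt_anti => //; case/andP: (mu_fine01 (mC i)).
  by apply: binom_lt_anti_size; [exact: mu_fine01|exact: leq_pred].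
have [Bad [mBad PBad hBad]] := many_balls Xindep Xlaw kappa mB mC BC trx Cu au01 n0N.
exists Bad; split => //; last first.
  by move=> w /hBad[i [t tn0 [Bt hC]]]; exists (x i), t.
rewrite probabilityE// lee_fin; apply: le_trans hMe.
rewrite -/M in PBad.
have n0u : n0%:R * (a * u) = v * G by rewrite au mulrC divfK// gt_eqF.
rewrite n0u in PBad.
have M2 : 0 < M ^+ 2 by rewrite exprn_gt0.
rewrite -(ler_pM2l M2); apply: (le_trans PBad).
rewrite [leRHS]mulrDr lerD2r [X in _ <= X * _]expr2 -[leRHS]mulrA ler_pM2l//.
by rewrite [M * _]mulrC divfK// gt_eqF.
Unshelve. all: by end_near. Qed.

(** * The three regimes *)

Lemma threshold_superlogarithmic (k : nat -> nat) (v rho : R) :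
  0 < rho < 1 -> 0 < v -> v < 1 -> (forall n, (0 < n)%N -> (0 < k n)%N) ->
  (forall M : R, \forall n \near \oo, M * ln n%:R <= (k n)%:R) ->
  (fun n : nat => (k n)%:R / (n%:R : R)) @ \oo --> (0 : R) ->
  {ae P, forall w, \forall n \near \oo,
    ((rho * v / a)%:E <=
      n%:R%:E * poweR (Lnk (fun i => X i w : A) n (k n)) d * ((k n)%:R^-1)%:E)%E}.
Proof.
move=> rho01 v0 v1 k0 klog kn.
have c10 : 0 < v / a by rewrite divr_gt0.
have [e e0 [r /= r0 hr]] := one_ball_rate rho01 c10 v0 v1.
pose u (j : nat) : R := v / a * ((k j)%:R / j%:R).
have rho0 : 0 < rho by case/andP: rho01.
apply: (@ae_threshold_ge k (fun n => (k n)%:R) id id k u rho) => //; last first.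
  move=> J; exists (maxn J 1) => // n /=; rewrite geq_max => /andP[Jn n0].
  exists n => //; split; rewrite ?leqnn//.
  have n1 : 0 < n%:R :> R by rewrite ltr0n.
  have kn1 : 0 < (k n)%:R :> R by rewrite ltr0n k0.
  by rewrite le_eqVlt; apply/orP; left; apply/eqP; rewrite /u; field; rewrite !gt_eqF.
near=> j.
have j0 : (1 < j)%N by near: j; exact: nbhs_infty_gt.
have jp : 0 < j%:R :> R by rewrite ltr0n (ltn_trans _ j0).
have kp : 0 < (k j)%:R :> R by rewrite ltr0n k0// (ltn_trans _ j0).
have uj : 0 < u j by rewrite mulr_gt0// divr_gt0.
split; first exact: ltW.
have [|||||Bad [mBad PBad hBad]] := hr (u j) _ uj (k j)%:R j j (k j) => //.
- rewrite /ball/= sub0r normrN gtr0_norm// /u -ltr_pdivlMl//.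
  near: j.
  have /cvgr0Pnorm_lt/(_ ((v / a)^-1 * r)) := kn.
  rewrite mulr_gt0 ?invr_gt0// => /(_ isT); apply: filterS => n; apply: le_lt_trans.
  exact: ler_norm.
- by rewrite le_eqVlt; apply/orP; left; apply/eqP; rewrite /u; field; rewrite !gt_eqF.
- by rewrite le_eqVlt; apply/orP; left; apply/eqP; rewrite /u; field; rewrite !gt_eqF.
- by rewrite mul1r ler_nat.
exists Bad; split => //; apply: (le_trans PBad); rewrite lee_fin.
apply: expR_le_inv_square; first by rewrite (ltn_trans _ j0).
have h6 : 6 / e * ln j%:R <= (k j)%:R by near: j; exact: klog.
have lj : ln j.+1%:R <= 2 * ln j%:R :> R.
  rewrite mulr_natl -lnXn// ler_ln ?posrE ?exprn_gt0// -natrX ler_nat.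
  apply: (@leq_trans (2 * j)); first by rewrite mul2n -addnn -addn1 leq_add2l ltnW.
  by rewrite expnS expn1 leq_mul2r j0 orbT.
have : e * (6 / e * ln j%:R) <= e * (k j)%:R by rewrite ler_pM2l.
have -> : e * (6 / e * ln j%:R) = 6 * ln j%:R by field; rewrite gt_eqF.
by lra.
Unshelve. all: by end_near. Qed.

(** With a single ball the exceptional probabilities are only small powers of the
    sample size; a high power [K] for the blocks makes them summable. *)
Lemma threshold_log_one_ball (k : nat -> nat) (v v' rho : R) :
  0 < rho < 1 -> 0 < v -> v < v' ->
  (\forall n \near \oo, v' * ln n%:R <= (k n)%:R) ->
  {ae P, forall w, \forall n \near \oo,
    ((rho ^+ 2 * v / a)%:E <=
      n%:R%:E * poweR (Lnk (fun i => X i w : A) n (k n)) d * ((ln n%:R)^-1)%:E)%E}.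
Proof.
move=> rho01 v0 vv' hk; pose v1 := (v + v') / 2.
have vv1 : v < v1 by rewrite /v1; lra.
have v1v' : v1 < v' by rewrite /v1; lra.
have v10 : 0 < v1 by lra.
have c10 : 0 < v / a by rewrite divr_gt0.
have [e e0 hu] := one_ball_rate rho01 c10 v10 v1v'.
pose K := (Num.truncn (3 / e)).+1.
have eK : 3 <= e * K%:R by rewrite -ler_pdivrMl// mulrC ltW// truncnS_gt.
apply: (@ae_log_threshold_ge k K (fun x => Num.truncn (v' * x)) v rho) => //.
- by move=> x y xy; apply: le_truncn; rewrite ler_wpM2l//; lra.
- apply: filterS hk => n hn; rewrite -(ler_nat R); apply: le_trans hn.
  have [h|h] := leP 0 (v' * ln n%:R); first by rewrite truncn_le.
  by have : 0 <= ln n%:R :> R; [case: n h => [|n] _; [rewrite ln0|rewrite ln_ge0// ler1n]|nra].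
have eta0 : 0 < (v1 - v) / v by rewrite divr_gt0// subr_gt0.
have hblog (Q : R -> Prop) : (\forall x \near +oo, Q x) -> \forall j \near \oo, Q (blog K j).
  exact: blog_pinfty.
have [J _ hJ] := hblog _ (near0_exp v0 hu).
near=> j.
have j0 : (0 < j)%N by near: j; exact: nbhs_infty_gt.
have G0 : 0 < blog K j :> R.
  by near: j; apply: (hblog (fun x => 0 < x)); apply: nbhs_pinfty_gt; exact: num_real.
have jJ : (J <= j)%N by near: j; exact: nbhs_infty_ge.
have hN : (bsize K j.+1)%:R <= (1 + (v1 - v) / v) * (bsize K j)%:R :> R.
  by near: j; exact: bsize_ratio.
have bp : 0 < (bsize K j)%:R :> R by rewrite ltr0n bsize_gt0.
move: (hJ j jJ) => /=; set u := v * blog K j * expR (- blog K j) / a => {}hu.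
have uE : u = v / a * blog K j / (bsize K j)%:R.
  by rewrite /u expRN expR_blog; field; rewrite !gt_eqF.
have [||||Bad [mBad PBad hBad]] := hu (blog K j) (bsize K j) (bsize K j.+1)
   (Num.truncn (v' * blog K j)).
- exact: ltW.
- by rewrite uE [leRHS]mulrC divfK// gt_eqF.
- apply: (@le_trans _ _ ((1 + (v1 - v) / v) * (bsize K j)%:R * (a * u))).
    by rewrite ler_wpM2r// mulr_ge0 ?(ltW ha)// uE divr_ge0// mulr_ge0// ltW.
  by rewrite le_eqVlt; apply/orP; left; apply/eqP; rewrite uE; field; rewrite !gt_eqF.
- by rewrite ltW// truncnS_gt.
exists Bad; split => //; apply: (le_trans PBad); rewrite lee_fin.
apply: expR_le_inv_square => //.
by rewrite blogE mulrA ler_wpM2r// ln_ge0// ler1n.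
Unshelve. all: by end_near. Qed.

Lemma threshold_log_many_balls (k : nat -> nat) (v v' rho : R) :
  0 < rho < 1 -> 0 <= v' -> v' <= v -> 0 < v -> v * H (v' / v) < b / d ->
  (\forall n \near \oo, ((Num.truncn (v' * ln n%:R)).+1 <= k n)%N) ->
  {ae P, forall w, \forall n \near \oo,
    ((rho ^+ 2 * v / a)%:E <=
      n%:R%:E * poweR (Lnk (fun i => X i w : A) n (k n)) d * ((ln n%:R)^-1)%:E)%E}.
Proof.
move=> rho01 v'0 v'v v0 hH hk.
have [e [eta [e0 eta0 hG]]] := many_balls_rate rho01 v'0 v'v v0 hH.
pose K := (Num.truncn (3 / e)).+1.
have eK : 3 <= e * K%:R by rewrite -ler_pdivrMl// mulrC ltW// truncnS_gt.
apply: (@ae_log_threshold_ge k K (fun x => (Num.truncn (v' * x)).+1) v rho) => //.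
  by move=> x y xy; rewrite ltnS; apply: le_truncn; rewrite ler_wpM2l.
have K0 : (0 < K)%N by [].
have [J _ hJ] := blog_pinfty K0 hG.
near=> j.
have j0 : (0 < j)%N by near: j; exact: nbhs_infty_gt.
have jJ : (J <= j)%N by near: j; exact: nbhs_infty_ge.
have hN : (bsize K j.+1)%:R <= (1 + eta) * (bsize K j)%:R :> R.
  by near: j; exact: bsize_ratio.
have [||Bad [mBad PBad hBad]] := hJ j jJ (bsize K j) (bsize K j.+1) _ _ hN.
- by rewrite expR_blog.
- by rewrite /bsize leq_exp2r.
exists Bad; split => //; apply: (le_trans PBad); rewrite lee_fin.
apply: (@le_trans _ _ (2 * expR (- (e * blog K j)))).
  by rewrite ler_peMl ?expR_ge0// ler1n.
apply: expR_le_inv_square => //.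
by rewrite blogE mulrA ler_wpM2r// ln_ge0// ler1n.
Unshelve. all: by end_near. Qed.

End packing.

Theorem proposition3p2 (R : realType) (A : pointedMetricType R)
    (mu : probability (borelType A) R)
    (d eps' : R) (hd : 0 < d) (heps' : 0 < eps')
    (hmu : forall (r : R) (x : A), 0 < r < 1 ->
      ((eps' * r `^ d)%:E <= mu (cball x r))%E)
    (disp : measure_display) (Omega : measurableType disp)
    (P : probability Omega R) (X : nat -> {RV P >-> borelType A})
    (hXindep : mutually_independent X)
    (hXdistr : forall (i : nat) (B : set (borelType A)), measurable B ->
      distribution P (X i) B = mu B)
    (beta : \bar R) (hbeta : (0 <= beta)%E)
    (k : nat -> nat) (hk : forall n : nat, (0 < n)%N -> (0 < k n)%N)
    (hk_log : (fun n : nat => ((k n)%:R / ln (n%:R : R))%:E) @ \oo --> beta)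
    (hk_n : (fun n : nat => (k n)%:R / (n%:R : R)) @ \oo --> (0 : R))
    (a b : R) (ha : 0 < a) (hb : 0 <= b)
    (hnu : bigOmega_at0 (fun r : R => packing_number mu r (a * r `^ d))
                        (fun r : R => r `^ (- b))) :
  {ae P, forall w : Omega,
    (beta = +oo%E ->
      ((a^-1)%:E <= limn_einf (fun n : nat =>
         n%:R%:E * poweR (Lnk (fun i => X i w : A) n (k n)) d
           * ((k n)%:R^-1)%:E))%E) /\
    ((beta < +oo)%E ->
      ((a^-1 * Hhat (fine beta) (b / d))%:E <= limn_einf (fun n : nat =>
         n%:R%:E * poweR (Lnk (fun i => X i w : A) n (k n)) d
           * ((ln (n%:R : R))^-1)%:E))%E)}.
Proof.
have lnpos : \forall n \near \oo, 0 < ln n%:R :> R.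
  by exists 2%N => // n /= n2; rewrite ln_gt0// ltr1n.
(* the bounds below lose a factor [rho ^+ 3], with [rho] as close to [1] as desired *)
have to1 (y l : R) : 0 < y -> l < y ->
    exists2 rho : R, 0 < rho < 1 & l <= rho ^+ 2 * (rho * y).
  move=> y0 ly; pose q := Num.max (l / y) 0.
  have q1 : q < 1 by rewrite gt_max ltr_pdivrMr// mul1r ly ltr01.
  have q0 : 0 <= q by rewrite le_max lexx orbT.
  have lq : l <= q * y by rewrite -ler_pdivrMr// le_max lexx.
  exists ((2 + q) / 3); first by apply/andP; split; lra.
  apply: (le_trans lq); rewrite mulrA ler_wpM2r ?(ltW y0)//.
  rewrite -exprSr -subr_ge0.
  have -> : ((2 + q) / 3) ^+ 3 - q = (1 - q) ^+ 2 * (8 + q) / 27 by field.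
  by rewrite divr_ge0// mulr_ge0 ?sqr_ge0//; lra.
have [betaoo|] := eqVneq beta +oo%E.
  suff : {ae P, forall w, ((a^-1)%:E <= limn_einf (fun n : nat =>
         n%:R%:E * poweR (Lnk (fun i => X i w : A) n (k n)) d
           * ((k n)%:R^-1)%:E))%E}.
    by apply: filterS => w hw; split => //; rewrite betaoo ltxx.
  apply: ae_le_limn_einf => l la.
  have ai0 : 0 < a^-1 by rewrite invr_gt0.
  have [rho rho01 hl] := to1 _ _ ai0 la.
  have rho201 : 0 < rho ^+ 2 < 1.
    by case/andP: rho01 => r0 r1; rewrite exprn_gt0//= exprn_ilt1// ltW.
  have [r0 r1] := andP rho01.
  have klog (M : R) : \forall n \near \oo, M * ln n%:R <= (k n)%:R.
    have : \forall n \near \oo, (M%:E <= ((k n)%:R / ln (n%:R : R))%:E)%E.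
      by move: hk_log; rewrite betaoo => /cvgeyPge; apply.
    apply: filterS2 lnpos => n n0; rewrite lee_fin ler_pdivlMr//.
  have := threshold_superlogarithmic hd heps' ha hmu hnu hXindep hXdistr rho201 r0 r1 hk klog hk_n.
  apply: filterS => w; apply: filterS => n; apply: le_trans.
  by rewrite lee_fin -mulrA.
rewrite -ltey => betafin.
have betaE : beta = (fine beta)%:E by rewrite fineK// ge0_fin_numE.
have b0 : 0 <= fine beta by exact: fine_ge0.
set B := fine beta in betaE b0 *; set y := Hhat B (b / d).
have bd0 : 0 <= b / d by rewrite divr_ge0// ltW.
have [yH By] := (Hhat_spec y b0 bd0).1 erefl.
suff : {ae P, forall w, ((a^-1 * y)%:E <= limn_einf (fun n : nat =>
         n%:R%:E * poweR (Lnk (fun i => X i w : A) n (k n)) d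
           * ((ln (n%:R : R))^-1)%:E))%E}.
  by apply: filterS => w hw; split => // boo; rewrite boo ltxx in betafin.
have klog (B' : R) : B' < B -> \forall n \near \oo, B' * ln n%:R <= (k n)%:R.
  move=> BB; have : \forall n \near \oo, B' < (k n)%:R / ln (n%:R : R).
    by move: hk_log; rewrite betaE => /fine_cvg/cvgr_gt; apply.
  apply: filterS2 lnpos => n n0; rewrite ltr_pdivlMr// => /ltW//.
have [y0|y0] := leP y 0.
  apply: filterE => w; apply: le_limn_einf; exists 2%N => // n n2.
  apply: (@le_trans _ _ 0%E).
    by rewrite lee_fin mulr_ge0_le0// invr_ge0 ltW.
  by rewrite mule_ge0// ?mule_ge0 ?poweR_ge0 ?lee_fin// invr_ge0 ln_ge0// ler1n ltnW.
apply: ae_le_limn_einf => l; rewrite mulrC ltr_pdivlMr// => ly.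
have [rho rho01 hl] := to1 _ _ y0 ly.
have [r0 r1] := andP rho01.
have v0 : 0 < rho * y by rewrite mulr_gt0.
suff : {ae P, forall w, \forall n \near \oo,
    ((rho ^+ 2 * (rho * y) / a)%:E <=
      n%:R%:E * poweR (Lnk (fun i => X i w : A) n (k n)) d * ((ln n%:R)^-1)%:E)%E}.
  apply: filterS => w; apply: filterS => n; apply: le_trans.
  by rewrite lee_fin ler_pdivlMr.
have [bz|bnz] := eqVneq b 0.
  (* the solution is [y = B], as [H 1 = 0] *)
  have yB : y = B.
    apply/(Hhat_spec B b0 bd0); rewrite lexx bz mul0r; split => //.
    have [->|Bn0] := eqVneq B 0; first by rewrite mul0r.
    by rewrite divff// /H oner_eq0 ln1 mulr0 addr0 subrr mulr0.
  rewrite yB in y0 v0 *.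
  have vB : rho * B < (rho + 1) / 2 * B by rewrite ltr_pM2r//; lra.
  have B1 : (rho + 1) / 2 * B < B by rewrite gtr_pMl//; lra.
  exact: (threshold_log_one_ball hd heps' ha hmu hnu hXindep hXdistr rho01 v0 vB (klog _ B1)).
have bd : 0 < b / d by rewrite divr_gt0// lt_neqAle eq_sym bnz.
(* [v * H (B / v)] is homogeneous in [(B, v)], so scaling the solution [y] by [rho]
   brings the exponent below [b / d] *)
apply: (@threshold_log_many_balls _ _ _ _ _ _ b hd heps' ha hmu hnu _ _ _ _ hXindep hXdistr
  k (rho * y) (rho * B)) => //.
- by rewrite mulr_ge0// ltW.
- by rewrite ler_wpM2l// ltW.
- have -> : rho * B / (rho * y) = B / y by field; rewrite !gt_eqF.
  by rewrite -mulrA yH gtr_pMl.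
have [B0|Bn0] := eqVneq B 0.
  by exists 1%N => // n /= n1; rewrite B0 mulr0 mul0r truncn0 hk.
have Bp : 0 < B by rewrite lt_neqAle eq_sym Bn0.
have B1 : (rho + 1) / 2 * B < B by rewrite gtr_pMl//; lra.
have D0 : 0 < (1 - rho) / 2 * B by rewrite mulr_gt0//; lra.
have lnbig : \forall n \near \oo, ((1 - rho) / 2 * B)^-1 <= ln n%:R :> R.
  have [J _ hJ] := @nbhs_infty_ger R (expR ((1 - rho) / 2 * B)^-1).
  exists J => // n /hJ /= hn; rewrite -ler_expR lnK// posrE.
  by apply: lt_le_trans hn; exact: expR_gt0.
apply: filterS3 lnpos lnbig (klog _ B1) => n n0 h1 h2.
rewrite -(ler_nat R); apply: le_trans h2.
have h3 : (Num.truncn (rho * B * ln n%:R))%:R <= rho * B * ln n%:R :> R.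
  by rewrite truncn_le// mulr_ge0// ?mulr_ge0// ltW.
have h4 : 1 <= (1 - rho) / 2 * B * ln n%:R.
  by rewrite -ler_pdivrMl// mulr1.
rewrite -natr1; lra.
Qed.
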